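(* Suppose that the kernel sets $\mathcal K_n$, $n\in\mathbb N^*$, satisfy conditions (1)--(5) listed in the context, that $s\in\mathbb L^2(\mathbb R^d)$, and that there exists $\alpha>0$ such that $\mathbb E(\exp(\alpha|\ell(Y_1)|))<\infty$. Then there exists a deterministic constant $\mathfrak c>0$, not depending on $n$, such that for every $\vartheta\in\,]0,1[$, $$\mathbb E\big(\|\widehat s_{\widehat K,\ell}(n;\cdot)-s\|_2^2\big)\leqslant(1+\vartheta)\min_{K\in\mathcal K_n}\mathbb E\big(\|\widehat s_{K,\ell}(n;\cdot)-s\|_2^2\big)+\frac{\mathfrak c}{\vartheta}\left(\|s_{K_0,\ell}-s\|_2^2+\frac{\log(n)^5}{n}\right).$$
   Context: Setting. Let $d\in\mathbb N^*$, and for $n\in\mathbb N^*$ let $(X_1,Y_1),\dots,(X_n,Y_n)$ be independent $\mathbb R^d\times\mathbb R$-valued random variables with the same distribution (not depending on $n$), assumed absolutely continuous with respect to Lebesgue measure; $f$ is a density of $X_1$. Let $\ell:\mathbb R\to\mathbb R$ be a Borel function and $s(x):=\mathbb E(\ell(Y_1)\mid X_1=x)f(x)$, $x\in\mathbb R^d$. Here $\|\cdot\|_2$ and $\langle\cdot,\cdot\rangle_2$ are the norm and inner product of $\mathbb L^2(\mathbb R^d)$ for Lebesgue measure. For each $n$, $\mathcal K_n$ is a (nonempty) set of symmetric continuous maps $K:\mathbb R^d\times\mathbb R^d\to\mathbb R$ (called kernels), of cardinality at most $n$. For $K\in\mathcal K_n$, $$\widehat s_{K,\ell}(n;x):=\frac1n\sum_{i=1}^nK(X_i,x)\ell(Y_i),\qquad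 s_{K,\ell}:=\mathbb E(\widehat s_{K,\ell}(n;\cdot))=\mathbb E(K(X_1,\cdot)\ell(Y_1)),\qquad \overline s_{K,\ell}:=\mathbb E(\|K(X_1,\cdot)\ell(Y_1)\|_2^2).$$ Conditions: there exist deterministic constants $\mathfrak m>0$ and $\overline{\mathfrak m}>0$, not depending on $n$, such that (1) for every $K\in\mathcal K_n$, $\sup_{x'\in\mathbb R^d}\|K(x',\cdot)\|_2^2\leqslant\mathfrak m\,n$; (2) for every $K\in\mathcal K_n$, $\|s_{K,\ell}\|_2^2\leqslant\mathfrak m$; (3) for every $K,K'\in\mathcal K_n$, $\mathbb E(\langle K(X_1,\cdot),K'(X_2,\cdot)\ell(Y_2)\rangle_2^2)\leqslant\mathfrak m\,\overline s_{K',\ell}$ (with $(X_2,Y_2)$ an independent copy of $(X_1,Y_1)$); (4) for every $K\in\mathcal K_n$ and $\psi\in\mathbb L^2(\mathbb R^d)$, $\mathbb E(\langle K(X_1,\cdot),\psi\rangle_2^2)\leqslant\mathfrak m\|\psi\|_2^2$; (5) $\mathbb E\big(\sup_{K,K'\in\mathcal K_n}\langle K(X_1,\cdot),s_{K',\ell}\rangle_2^2\big)\leqslant\overline{\mathfrak m}$. Selection procedure. $K_0$ is a (deterministic) element of $\arg\max_{K\in\mathcal K_n}\{\sup_{x\in\mathbb R^d}|K(x,x)|\}$, $$\mathrm{pen}_\ell(K):=\frac{2}{n^2}\sum_{i=1}^n\langle K(\cdot,X_i),K_0(\cdot,X_i)\rangle_2\,\ell(Y_i)^2,\qquad K\in\mathcal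 K_n,$$ and $\widehat K$ is a (data-dependent) element of $\arg\min_{K\in\mathcal K_n}\{\|\widehat s_{K,\ell}(n;\cdot)-\widehat s_{K_0,\ell}(n;\cdot)\|_2^2+\mathrm{pen}_\ell(K)\}$. *)

(* Defs.v *)
From HB Require Import structures.
From mathcomp Require Import all_boot all_order all_algebra.
From mathcomp Require Import all_classical all_reals all_analysis.
Set Implicit Arguments.
Unset Strict Implicit.
Unset Printing Implicit Defensive.
Import Order.TTheory GRing.Theory Num.Theory.
Import numFieldNormedType.Exports.
Local Open Scope classical_set_scope.
Local Open Scope ring_scope.

(* R^d is 'rV[R]_d, with the sigma-algebra generated by the coordinates, that
   is, the Borel sigma-algebra of its (product) topology. *)
Section measurable_rV.
Context (R : realType) (d : nat).

Definition rV_coord (i : 'I_d) (v : 'rV[R]_d) : R := v ord0 i.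

Let rV0 : g_sigma_preimage rV_coord set0.
Proof. exact: sigma_algebra0. Qed.

Let rVC A : g_sigma_preimage rV_coord A -> g_sigma_preimage rV_coord (~` A).
Proof. exact: sigma_algebraC. Qed.

Let rVU (F : (set 'rV[R]_d)^nat) : (forall i, g_sigma_preimage rV_coord (F i)) ->
  g_sigma_preimage rV_coord (\bigcup_i F i).
Proof. exact: sigma_algebra_bigcup. Qed.

HB.instance Definition _ := @isMeasurable.Build default_measure_display
  'rV[R]_d (g_sigma_preimage rV_coord) rV0 rVC rVU.

End measurable_rV.

Section measurable_fun_rV.
Context (R : realType) (d : nat).

Lemma measurable_rV_coord (i : 'I_d) :
  measurable_fun setT (@rV_coord R d i).
Proof.
move=> _ Y mY; rewrite setTI; apply: sub_sigma_algebra => /=.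
rewrite -bigcup_seq/=; exists i => /=; first by rewrite mem_index_enum.
by exists Y => //; rewrite setTI.
Qed.

Lemma measurable_fun_rV d' (T : measurableType d') (g : T -> 'rV[R]_d) :
  (forall i, measurable_fun setT (fun x => g x ord0 i)) ->
  measurable_fun setT g.
Proof.
move=> mg; pose S := [set A : set 'rV[R]_d | measurable (g @^-1` A)].
suff H : g_sigma_preimage (@rV_coord R d) `<=` S.
  by move=> _ A mA; rewrite setTI; exact: H.
apply: smallest_sub.
  split.
  - by rewrite /S/= preimage_set0; exact: measurable0.
  - move=> A SA; rewrite /S/= setTD preimage_setC; exact: measurableC.
  - move=> F SF; rewrite /S/= preimage_bigcup.
    by apply: bigcupT_measurable => k; exact: SF.
rewrite -bigcup_seq => A [i _ [B mB <-]]; rewrite /S/= setTI.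
by have := mg i measurableT _ mB; rewrite setTI.
Qed.

End measurable_fun_rV.

Section lebesgue_rV.
Context (R : realType).

Definition rV_cons n (p : measurableTypeR R * 'rV[R]_n) : 'rV[R]_n.+1 :=
  row_mx (const_mx p.1 : 'rV[R]_1) p.2.

Definition rV_uncons n (v : 'rV[R]_n.+1) : measurableTypeR R * 'rV[R]_n :=
  (v ord0 ord0, \row_j v ord0 (lift ord0 j)).

Lemma rV_cons0 n (p : measurableTypeR R * 'rV[R]_n) : rV_cons p ord0 ord0 = p.1.
Proof.
rewrite /rV_cons (_ : ord0 = lshift n (ord0 : 'I_1)); last exact: val_inj.
by rewrite (row_mxEl (const_mx p.1 : 'rV_1)) mxE.
Qed.

Lemma rV_consS n (p : measurableTypeR R * 'rV[R]_n) j : rV_cons p ord0 (lift ord0 j) = p.2 ord0 j.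
Proof.
rewrite /rV_cons (_ : lift ord0 j = rshift 1 j); last exact: val_inj.
by rewrite (row_mxEr (const_mx p.1 : 'rV_1)).
Qed.

Lemma rV_consK n : cancel (@rV_cons n) (@rV_uncons n).
Proof.
move=> [t v]; rewrite /rV_uncons rV_cons0; congr pair.
by apply/rowP => j; rewrite mxE rV_consS.
Qed.

Lemma rV_unconsK n : cancel (@rV_uncons n) (@rV_cons n).
Proof.
move=> v; apply/rowP => i; case: (unliftP ord0 i) => [j|] ->.
  by rewrite rV_consS mxE.
by rewrite rV_cons0.
Qed.

Lemma measurable_rV_cons n : measurable_fun setT (@rV_cons n).
Proof.
apply: measurable_fun_rV => i; case: (unliftP ord0 i) => [j|] ->.
  rewrite (_ : (fun _ => _) = @rV_coord R n j \o snd).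
    exact: measurableT_comp (measurable_rV_coord j) measurable_snd.
  by apply/funext => p; rewrite rV_consS.
rewrite (_ : (fun _ => _) = fst); first exact: measurable_fst.
by apply/funext => p; rewrite rV_cons0.
Qed.

Lemma measurable_rV_uncons n : measurable_fun setT (@rV_uncons n).
Proof.
apply: measurable_fun_pair => /=.
  exact: (measurable_rV_coord ord0).
apply: measurable_fun_rV => i.
rewrite (_ : (fun _ => _) = @rV_coord R n.+1 (lift ord0 i)).
  exact: measurable_rV_coord.
by apply/funext => v; rewrite mxE.
Qed.

Section step.
Context (n : nat) (m : {sigma_finite_measure set 'rV[R]_n -> \bar R}).

Definition lebesgue_rV_step : set 'rV[R]_n.+1 -> \bar R :=
  pushforward (lebesgue_measure \x m)%E (@rV_cons n).

Let mcons A : measurable A -> measurable (@rV_cons n @^-1` A).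
Proof. by move=> mA; rewrite -[X in measurable X]setTI; exact: measurable_rV_cons. Qed.

Let step0 : lebesgue_rV_step set0 = 0%E.
Proof. by rewrite /lebesgue_rV_step /pushforward preimage_set0 measure0. Qed.

Let step_ge0 A : (0 <= lebesgue_rV_step A)%E.
Proof. by rewrite /lebesgue_rV_step /pushforward; exact: measure_ge0. Qed.

Let step_sigma_additive : semi_sigma_additive lebesgue_rV_step.
Proof.
move=> F mF tF mUF; rewrite /lebesgue_rV_step /pushforward preimage_bigcup.
apply: measure_semi_sigma_additive.
- by move=> k; exact: mcons.
- apply/trivIsetP => /= i j _ _ ij; rewrite -preimage_setI.
  by move/trivIsetP : tF => /(_ _ _ _ _ ij) ->//; rewrite preimage_set0.
- by rewrite -preimage_bigcup; exact: mcons.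
Qed.

HB.instance Definition _ := isMeasure.Build _ _ _ lebesgue_rV_step
  step0 step_ge0 step_sigma_additive.

Let step_sigma_finite : sigma_finite setT lebesgue_rV_step.
Proof.
have /sigma_finiteP[F [TF ndF Foo]] := sigma_finiteT (@lebesgue_measure R).
have /sigma_finiteP[G [TG ndG Goo]] := sigma_finiteT m.
exists (fun k => @rV_uncons n @^-1` (F k `*` G k)) => [|k].
  rewrite -preimage_bigcup -[LHS](preimage_setT (@rV_uncons n)); congr (_ @^-1` _).
  rewrite -setXTT TF TG predeqE => -[x y]; split.
    move=> [/= [p _ Fpx] [k _ Gky]]; exists (maxn p k) => //; split.
    - by move: x Fpx; exact/subsetPset/ndF/leq_maxl.
    - by move: y Gky; exact/subsetPset/ndG/leq_maxr.
  by move=> [p _ []/= ? ?]; split; exists p.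
have [mF Fk] := Foo k; have [mG Gk] := Goo k; split.
  rewrite -[X in measurable X]setTI.
  by apply: measurable_rV_uncons => //; exact: measurableX.
rewrite /lebesgue_rV_step /pushforward -comp_preimage.
rewrite (_ : _ \o _ = id); last by apply/funext => p /=; rewrite rV_consK.
by rewrite preimage_id product_measure1E// lte_mul_pinfty// ge0_fin_numE.
Qed.

HB.instance Definition _ :=
  @Measure_isSigmaFinite.Build _ _ _ lebesgue_rV_step step_sigma_finite.

End step.

(* The d-fold product of [lebesgue_measure], transported along the bijections
   [rV_cons]; see [lebesgue_rV_box]. *)
Fixpoint lebesgue_rV d : {sigma_finite_measure set 'rV[R]_d -> \bar R} :=
  match d with
  | 0%N => (\d_(0 : 'rV[R]_0) : {sigma_finite_measure set 'rV[R]_0 -> \bar R})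
  | n.+1 => lebesgue_rV_step (lebesgue_rV n)
  end.

Lemma lebesgue_rV_box d (A : 'I_d -> set R) : (forall i, measurable (A i)) ->
  lebesgue_rV d [set v | forall i, A i (v ord0 i)] =
  (\prod_(i < d) lebesgue_measure (A i))%E.
Proof.
elim: d A => [A _|d IH A mA].
  rewrite big_ord0 /= diracE mem_set//= => -[]//.
rewrite big_ord_recl -IH//.
pose B := [set v : 'rV[R]_d | forall i, A (lift ord0 i) (v ord0 i)].
have mB : measurable B.
  rewrite (_ : B = \bigcap_(i in [set: 'I_d])
      (@rV_coord R d i @^-1` A (lift ord0 i))); last first.
    by apply/seteqP; split=> v /= H i; [move=> _|]; exact: H.
  apply: fin_bigcap_measurable => // i _; rewrite -[X in measurable X]setTI.
  exact: (measurable_rV_coord i).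
transitivity ((lebesgue_measure \x lebesgue_rV d)%E (A ord0 `*` B)).
  rewrite -[LHS]/((lebesgue_measure \x lebesgue_rV d)%E (@rV_cons d @^-1` _)).
  congr (_ _); apply/seteqP; split=> -[t v] /=.
    move=> H; split; first by have := H ord0; rewrite rV_cons0.
    by move=> i; have := H (lift ord0 i); rewrite rV_consS.
  move=> [At Bv] i; case: (unliftP ord0 i) => [j|] ->.
    by rewrite rV_consS; exact: Bv.
  by rewrite rV_cons0.
exact: (@product_measure1E _ _ (measurableTypeR R) _ _ lebesgue_measure
  (lebesgue_rV d) (A ord0) B (mA ord0) mB).
Qed.

End lebesgue_rV.

Section independence.
Context d d' (Omega : measurableType d) (T : measurableType d') (R : realType).
Variable P : probability Omega R.

Definition mutually_independent (I : finType) (Z : I -> Omega -> T) :=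
  forall (J : {set I}) (A : I -> set T), (forall i, measurable (A i)) ->
    P (\bigcap_(i in [set` J]) Z i @^-1` A i) =
    (\prod_(i in J) P (Z i @^-1` A i))%E.

Definition iid_with_law (mu : probability T R) (I : finType)
    (Z : I -> {RV P >-> T}) :=
  (forall i A, measurable A -> distribution P (Z i) A = mu A) /\
  mutually_independent Z.

Definition sample n (Z : 'I_n -> {RV P >-> T}) (w : Omega) : n.-tuple T :=
  [tuple Z i w | i < n].

End independence.

Section argopt.
Context (T : Type) (R : realType).

Definition is_argmin (A : set T) (F : T -> \bar R) (a : T) :=
  A a /\ forall b, A b -> (F a <= F b)%E.

Definition is_argmax (A : set T) (F : T -> \bar R) (a : T) :=
  A a /\ forall b, A b -> (F b <= F a)%E.

End argopt.

Section kernel_estimation.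
Context (R : realType) (d : nat).
Local Notation E := 'rV[R]_d.
Local Notation leb := (lebesgue_rV R d).

Definition l2norm_sq (g : E -> R) : \bar R := ('N[leb]_(2%:E)[EFin \o g] ^+ 2)%E.

Definition l2inner (g h : E -> R) : R := \int[leb]_x (g x * h x).

Definition is_kernel (K : E -> E -> R) :=
  (forall x y, K x y = K y x) /\ continuous (fun xy : E * E => K xy.1 xy.2).

Definition diag_sup (K : E -> E -> R) : \bar R :=
  ereal_sup (range (fun x => `|K x x|%:E)).

(* [mu] is the law of (X_1, Y_1): an expectation of a function of (X_1, Y_1) is
   an integral against [mu], and one of a function of (X_1, Y_1) and of an
   independent copy (X_2, Y_2) is an integral against [mu \x mu]. *)
Section law.
Variables (mu : probability (E * R)%type R) (ell : R -> R).

Definition is_density_X (f : E -> R) :=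
  [/\ measurable_fun setT f, forall x, 0 <= f x &
    forall A, measurable A ->
      mu (fst @^-1` A) = (\int[leb]_(x in A) (f x)%:E)%E].

(* [r] is a version of x |-> E(ell(Y_1) | X_1 = x) *)
Definition is_regression (r : E -> R) :=
  [/\ measurable_fun setT r, mu.-integrable setT (fun z => (r z.1)%:E) &
    forall A, measurable A ->
      (\int[mu]_(z in fst @^-1` A) (r z.1)%:E =
       \int[mu]_(z in fst @^-1` A) (ell z.2)%:E)%E].

Definition mean_estimator (K : E -> E -> R) (x : E) : R :=
  \int[mu]_z (K z.1 x * ell z.2).

Definition mean_sq_norm (K : E -> E -> R) : \bar R :=
  (\int[mu]_z l2norm_sq (fun x => (K z.1 x * ell z.2)%R))%E.

Record kernel_set_conditions (n : nat) (KK : set (E -> E -> R)) (m mbar : R) :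
    Prop := {
  cond_norm : forall K, KK K ->
    (ereal_sup (range (fun x' => l2norm_sq (K x'))) <= (m * n%:R)%:E)%E ;
  cond_mean : forall K, KK K -> (l2norm_sq (mean_estimator K) <= m%:E)%E ;
  cond_cross : forall K K', KK K -> KK K' ->
    (\int[mu \x mu]_z
       ((l2inner (K z.1.1) (fun x => K' z.2.1 x * ell z.2.2)) ^+ 2)%:E
     <= m%:E * mean_sq_norm K')%E ;
  cond_weak : forall K psi, KK K -> psi \in Lfun leb 2%:E ->
    (\int[mu]_z ((l2inner (K z.1) psi) ^+ 2)%:E <= m%:E * l2norm_sq psi)%E ;
  cond_sup :
    (\int[mu]_z ereal_sup [set ((l2inner (K z.1) (mean_estimator K')) ^+ 2)%:E
       | K in KK & K' in KK] <= mbar%:E)%E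
}.

End law.

Section statistics.
Variables (ell : R -> R) (n : nat) (z : n.-tuple (E * R)).
Let X i := (tnth z i).1.
Let Y i := (tnth z i).2.

Definition estimator (K : E -> E -> R) (x : E) : R :=
  n%:R^-1 * \sum_(i < n) K (X i) x * ell (Y i).

Definition penalty (K0 K : E -> E -> R) : R :=
  2 / n%:R ^+ 2 *
  \sum_(i < n) l2inner (K ^~ (X i)) (K0 ^~ (X i)) * ell (Y i) ^+ 2.

Definition criterion (K0 K : E -> E -> R) : \bar R :=
  (l2norm_sq (fun x => (estimator K x - estimator K0 x)%R) + (penalty K0 K)%:E)%E.

End statistics.

End kernel_estimation.

(* Main.v *)
(* Write a_i = K(X_i,.) ell(Y_i), b_i = a_i - s_K and g_K for the mean of the b_i.
   The criterion of K is the loss |shat_K - s|^2 minus twice an error term, up to a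
   quantity that does not depend on K, so it suffices to bound the error term by
   t |shat_K - s|^2 + O(1/t) uniformly in K. Its parts are <s_K - s, g_K0>, terms
   handled by Cauchy-Schwarz, and the degenerate U-statistic
   U = sum_{i <> j} <b_i^K, b_j^{K0}> / n^2.
   Averaging over subsets I of {1..n}, U is 4 times the mean of <G_I, G'_{~I}> / n^2
   with G_I and G'_{~I} partial sums over disjoint blocks, hence independent: given
   G_I, the product is a sum of independent centred variables whose weak variance is
   controlled by condition (4), and a Bernstein-type exponential moment bounds it by
   t |G_I|^2 + O(log^4 n / t), with a union bound over the n kernels. The mean of
   |G_I|^2 over I is (|G|^2 + sum_i |b_i|^2) / 4, and the same estimate for the pair
   (K, K) shows that sum_i |b_i|^2 is at most of the order of |G|^2: U is thus
   controlled by the loss itself. Truncation at |ell(Y_i)| <= L with L of order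
   log n costs O(1/n) because ell(Y) has an exponential moment. *)
Require Import Defs.
From HB Require Import structures.
From mathcomp Require Import all_boot all_order all_algebra.
From mathcomp Require Import all_classical all_reals all_analysis.
From mathcomp Require Import measurable_realfun ring lra.
Set Implicit Arguments.
Unset Strict Implicit.
Unset Printing Implicit Defensive.
Import Order.TTheory GRing.Theory Num.Theory.
Import numFieldNormedType.Exports.
Local Open Scope classical_set_scope.
Local Open Scope ring_scope.

(** * Measurability of continuous kernels *)

(** All fluctuation bounds have the form x <= t a + rho / t, with one random rho that serves every t
    > 0. The oracle inequality therefore holds path by path, for all theta at once (t = theta / 30),
    and only its remainder is integrated at the end. The exponentials are averaged over the subsets
    I, not maximised, so the union bound runs over the n kernels and never over the 2^n subsets. It
    is absorbed by y^2 <= 2 x^2 + 4 exp(y - x) at x = log n; with the squared range L^2 this gives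
    log^4 n / n, one logarithm less than the statement allows. The function ell itself is not
    truncated: the indicator that all |ell(Y_i)| <= L multiplies the exponentials, so the b_i stay
    exactly centred, and on the complementary event the risk is bounded crudely. The space of
    square-integrable functions carries no sigma-algebra here: a random direction is handled only
    through the measurability of its inner products. Independence enters as an identity that
    replaces one coordinate of the sample by a fresh copy. *)

Section continuous_measurable.
Context (R : realType) (d : nat).
Local Notation E := 'rV[R]_d.

(** The integer vectors form a countable set, so for an arbitrary [h] the preimage of any set is a
    countable union of cells, each a finite intersection of preimages of half-open intervals. *)
Lemma measurable_floor_cells d' (T : measurableType d') (I : finType)
    (v : I -> T -> R) (h : {ffun I -> int} -> R) :
  (forall i, measurable_fun setT (v i)) ->
  measurable_fun setT (fun p => h [ffun i => Num.floor (v i p)]).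
Proof.
move=> mv _ A _; rewrite setTI.
pose F (c : {ffun I -> int}) :=
  if h c \in A then [set p | forall i, Num.floor (v i p) = c i] else set0.
rewrite (_ : _ @^-1` A = \bigcup_c F c); last first.
  apply/seteqP; split=> [p /= Ap|p [c _]].
    exists [ffun i => Num.floor (v i p)] => //; rewrite /F mem_set//= => i.
    by rewrite ffunE.
  rewrite /F; case: ifPn => // /set_mem hc /= pc.
  by rewrite (_ : finfun _ = c)//; apply/ffunP => i; rewrite ffunE.
apply: countable_bigcupT_measurable; first exact: countableP.
move=> c; rewrite /F; case: ifPn => // _.
rewrite (_ : mkset _ = \bigcap_(i in [set: I])
    (v i @^-1` `[(c i)%:~R, (c i + 1)%:~R[%classic)); last first.
  apply/seteqP; split=> p /= H i; last first.
    by apply: floor_def; have := H i Logic.I; rewrite /= in_itv.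
  by move=> _ /=; rewrite in_itv/= -(H i) floor_itv.
apply: fin_bigcap_measurable => // i _; rewrite -[X in measurable X]setTI.
exact: mv.
Qed.

(* [g] is the pointwise limit of its values at the grid points of mesh
   [1 / k.+1], and the grid map has countably many values. *)
Lemma measurable_continuous2 (g : E * E -> R) :
  continuous g -> measurable_fun setT g.
Proof.
move=> cg.
pose h k (c : {ffun 'I_d + 'I_d -> int}) : E * E :=
  (\row_j ((c (inl j))%:~R / k.+1%:R), \row_j ((c (inr j))%:~R / k.+1%:R)).
pose v k (i : 'I_d + 'I_d) (p : E * E) : R :=
  k.+1%:R * (match i with inl j => p.1 ord0 j | inr j => p.2 ord0 j end).
apply: (@measurable_fun_cvg _ _ _ _
  (fun k p => g (h k [ffun i => Num.floor (v k i p)]))) => [k|p _].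
  apply: (measurable_floor_cells (fun c => g (h k c))) => -[] j;
    apply: measurable_funM => //; apply: (measurableT_comp (measurable_rV_coord j));
    [exact: measurable_fst|exact: measurable_snd].
(* The rounding error is below [1 / k.+1] whatever the point, so one rank serves all coordinates. *)
have H e : 0 < e -> \forall k \near \oo, forall x : R,
    ball x e ((Num.floor (k.+1%:R * x))%:~R / k.+1%:R).
  move=> e0; near=> k => x.
  have k0 : 0 < k.+1%:R :> R by rewrite ltr0n.
  rewrite /ball/= ger0_norm; last first.
    by rewrite subr_ge0 ler_pdivrMr// (mulrC x); exact: floor_le.
  rewrite ltrBlDl -(ltr_pM2r k0) mulrDl divfK ?gt_eqF// (mulrC x).
  apply: lt_le_trans (floorD1_gt _) _; rewrite intrD lerD2l/=.
  rewrite mulrC -ler_pdivrMl// mulr1; near: k.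
  by move: (near_infty_natSinv_lt (PosNum e0)); apply: filterS => k /= /ltW.
suff hp : h k [ffun i => Num.floor (v k i p)] @[k --> \oo] --> p.
  exact: (cvg_comp _ _ hp (cg p)).
have rnd (x : E) (u : nat -> E) : (forall k j, u k ord0 j =
    (Num.floor (k.+1%:R * x ord0 j))%:~R / k.+1%:R) -> u k @[k --> \oo] --> x.
  move=> uE; apply/cvg_ballP => e e0; apply: filterS (H e e0) => k Hk; split=> // i j.
  by rewrite ord1 uE; exact: Hk.
case: p => x y; apply: (@cvg_pair _ _ _ _ (nbhs x) (nbhs y)) => /=; apply: rnd => k j;
  by rewrite mxE ffunE.
Unshelve. all: by end_near. Qed.

End continuous_measurable.

(** * Positive semidefinite forms and random splitting *)

Section psd_form.
Context (R : realFieldType) (V : lmodType R).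

(** Semi-definite rather than definite: the form will be the L2 product on functions, not on classes
    modulo null sets, so a nonzero vector can have norm 0. *)
Record psd_form (B : V -> V -> R) : Prop := {
  psdC : forall u v, B u v = B v u ;
  psdP : forall a u v w, B (a *: u + v) w = a * B u w + B v w ;
  psd_ge0 : forall u, 0 <= B u u }.

Variable B : V -> V -> R.
Hypothesis hB : psd_form B.

Lemma psdDl u v w : B (u + v) w = B u w + B v w.
Proof. by rewrite -[u]scale1r (psdP hB) mul1r scale1r. Qed.

Lemma psd0l w : B 0 w = 0.
Proof. by apply/(addrI (B 0 w)); rewrite -psdDl !addr0. Qed.

Lemma psdZl a u w : B (a *: u) w = a * B u w.
Proof. by rewrite -[a *: u]addr0 (psdP hB) psd0l addr0. Qed.

Lemma psdNl u w : B (- u) w = - B u w.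
Proof. by rewrite -scaleN1r psdZl mulN1r. Qed.

Lemma psdBl u v w : B (u - v) w = B u w - B v w.
Proof. by rewrite psdDl psdNl. Qed.

Lemma psd_suml (I : Type) (r : seq I) (P : pred I) (F : I -> V) w :
  B (\sum_(i <- r | P i) F i) w = \sum_(i <- r | P i) B (F i) w.
Proof. by apply: (big_morph (B^~ w)) => [u v|]; rewrite ?psdDl ?psd0l. Qed.

Lemma psdDr u v w : B w (u + v) = B w u + B w v.
Proof. by rewrite !(psdC hB w) psdDl. Qed.

Lemma psdZr a u w : B w (a *: u) = a * B w u.
Proof. by rewrite !(psdC hB w) psdZl. Qed.

Lemma psdNr u w : B w (- u) = - B w u.
Proof. by rewrite !(psdC hB w) psdNl. Qed.

Lemma psdBr u v w : B w (u - v) = B w u - B w v.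
Proof. by rewrite !(psdC hB w) psdBl. Qed.

Lemma psd_sumr (I : Type) (r : seq I) (P : pred I) (F : I -> V) w :
  B w (\sum_(i <- r | P i) F i) = \sum_(i <- r | P i) B w (F i).
Proof. by rewrite (psdC hB) psd_suml; apply: eq_bigr => i _; rewrite (psdC hB). Qed.

Lemma psd_young t u v : 0 < t -> 2 * `|B u v| <= t * B u u + t^-1 * B v v.
Proof.
move=> t0; have t1 : t * t^-1 = 1 by rewrite mulfV ?gt_eqF.
(* [e] is the sign of [B u v]; the claim is the expansion of the square of [t *: u - e *: v],
   divided by [t]. *)
have H e : e ^+ 2 = 1 -> 2 * (e * B u v) <= t * B u u + t^-1 * B v v.
  move=> e1; have := psd_ge0 hB (t *: u - e *: v).
  rewrite !(psdBl, psdBr, psdZl, psdZr) (psdC hB v u) -(ler_pM2l (_ : 0 < t^-1)) ?invr_gt0//.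
  rewrite mulr0; set x := B u u; set y := B u v; set z := B v v.
  rewrite [leRHS](_ : _ =
    (t * t^-1) * (t * x) - (t * t^-1) * (2 * (e * y)) + e ^+ 2 * (t^-1 * z)); last by ring.
  by rewrite t1 e1 !mul1r; lra.
by have [_|_] := ger0P (B u v); [rewrite -[B u v]mul1r|rewrite -[- B u v]mulN1r];
  apply: H; rewrite ?expr1n ?sqrrN ?expr1n.
Qed.

Lemma psd_cauchy_schwarz u v : B u v ^+ 2 <= B u u * B v v.
Proof.
have u0 := psd_ge0 hB u; have v0 := psd_ge0 hB v.
have [->|uv] := eqVneq (B u v) 0; first by rewrite expr0n mulr_ge0.
have uv0 : 0 < `|B u v| by rewrite normr_gt0.
have [vz|vn] := eqVneq (B v v) 0.
  (* Here [v] is a null vector, possibly nonzero. This weight gives 2 |B u v| <= |B u v|, against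
     [uv0]. *)
  have := psd_young u v (_ : 0 < `|B u v| / (B u u + 1)).
  rewrite vz mulr0 addr0 => /(_ _)/wrap[]; first by rewrite divr_gt0// ltr_pwDr.
  have : `|B u v| / (B u u + 1) * B u u <= `|B u v|.
    by rewrite -mulrA ger_pMr// mulrC ler_pdivrMr ?ltr_pwDr// mul1r lerDl.
  lra.
have vp : 0 < B v v by rewrite lt_def vn.
have := psd_young u v (_ : 0 < B v v / `|B u v|).
move=> /(_ _)/wrap[]; first by rewrite divr_gt0.
rewrite invf_div divfK// => H.
have {}H : `|B u v| <= B v v / `|B u v| * B u u by lra.
by move: H; rewrite mulrAC ler_pdivlMr// -expr2 real_normK ?num_real// mulrC.
Qed.

Lemma psdD_le u v : B (u + v) (u + v) <= 2 * (B u u + B v v).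
Proof.
have := psd_ge0 hB (u - v).
by rewrite !(psdDl, psdDr, psdNl, psdNr) (psdC hB v u); lra.
Qed.

Lemma psd_sum_le n (u : 'I_n -> V) :
  B (\sum_i u i) (\sum_i u i) <= n%:R * \sum_i B (u i) (u i).
Proof.
elim: n u => [|[_|n IH]] u; first by rewrite !big_ord0 psd0l mul0r.
  by rewrite !big_ord1 mul1r.
rewrite big_ord_recl [in leRHS]big_ord_recl psdDl !psdDr.
set x := \sum_(i < n.+1) u (lift ord0 i); set y := u ord0.
have np : 0 < n.+1%:R :> R by rewrite ltr0n.
have := psd_young y x np; have := IH (fun i => u (lift ord0 i)); rewrite -/x.
set S := \sum_(i < n.+1) B (u (lift ord0 i)) (u (lift ord0 i)); rewrite -[n.+2%:R]natr1.
set k : R := n.+1%:R in np * => H1 H2.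
have {}H1 : k^-1 * B x x <= S by rewrite mulrC ler_pdivrMr// mulrC.
have := ler_norm (B y x) => H3; rewrite (psdC hB x y).
have H4 : B x x <= k * S by rewrite -ler_pdivrMl.
have {}H2 : 2 * `|B y x| <= k * B y y + S by apply: le_trans H2 _; rewrite lerD2l.
by rewrite mulrDl mul1r mulrDr; lra.
Qed.

End psd_form.

Section random_splitting.
Context (R : realFieldType) (n : nat).
Implicit Types (I : {set 'I_n}) (i j : 'I_n).

Let N : R := (2 ^ n)%:R.

(** Toggling [i] permutes the subsets, flips the sign [sg i] and keeps every other sign; hence the
    sums of these characters, and of products of two distinct ones, vanish. *)
Let toggle i I : {set 'I_n} := [set k | (k \in I) (+) (k == i)].

Let toggleK i : involutive (toggle i).
Proof. by move=> I; apply/setP => k; rewrite !inE -addbA addbb addbF. Qed.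

Let sg i I : R := (-1) ^+ (i \in I).

Let sg_toggle i j I : sg j (toggle i I) = (if j == i then -1 else 1) * sg j I.
Proof.
by rewrite /sg inE signr_addb mulrC; case: eqP.
Qed.

Let sum_sg i : \sum_I sg i I = 0.
Proof.
have : \sum_I sg i I = - \sum_I sg i I.
  rewrite {1}(reindex_inj (inv_inj (toggleK i)))/= -sumrN.
  by apply: eq_bigr => I _; rewrite sg_toggle eqxx mulN1r.
lra.
Qed.

Let sum_sg2 i j : i != j -> \sum_I sg i I * sg j I = 0.
Proof.
move=> ij; have : \sum_I sg i I * sg j I = - \sum_I sg i I * sg j I.
  rewrite {1}(reindex_inj (inv_inj (toggleK i)))/= -sumrN.
  apply: eq_bigr => I _; rewrite !sg_toggle eqxx eq_sym (negbTE ij) mulN1r mul1r.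
  by rewrite mulNr.
lra.
Qed.

Let inE_sg i I : (i \in I)%:R = (1 - sg i I) / 2.
Proof. by rewrite /sg; case: (i \in I) => /=; rewrite ?expr1 ?expr0; lra. Qed.

Let sum_one : \sum_(I : {set 'I_n}) 1 = N :> R.
Proof.
rewrite sumr_const -cardsT -powersetT card_powerset cardsT card_ord.
by [].
Qed.

Lemma sum_indicator_split i j : i != j ->
  4 * \sum_(I : {set 'I_n}) ((i \in I)%:R * (j \notin I)%:R : R) = N.
Proof.
move=> ij; transitivity (\sum_I (1 - sg i I + sg j I - sg i I * sg j I)).
  rewrite mulr_sumr; apply: eq_bigr => I _.
  have -> : (j \notin I)%:R = 1 - (j \in I)%:R :> R.
    by case: (j \in I); rewrite /= ?subrr ?subr0.
  by rewrite !inE_sg; field.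
by rewrite !(sumrB, big_split)/= sum_one !sum_sg sum_sg2// !subr0 addr0.
Qed.

Lemma sum_indicator_diag i : 2 * \sum_(I : {set 'I_n}) ((i \in I)%:R : R) = N.
Proof.
transitivity (\sum_I (1 - sg i I)); last by rewrite sumrB sum_one sum_sg subr0.
by rewrite mulr_sumr; apply: eq_bigr => I _; rewrite !inE_sg; field.
Qed.

Lemma sum_indicator_pair i j : i != j ->
  4 * \sum_(I : {set 'I_n}) ((i \in I)%:R * (j \in I)%:R : R) = N.
Proof.
move=> ij; transitivity (\sum_I (1 - sg i I - sg j I + sg i I * sg j I)).
  by rewrite mulr_sumr; apply: eq_bigr => I _; rewrite !inE_sg; field.
by rewrite !(sumrB, big_split)/= sum_one !sum_sg sum_sg2// !subr0 addr0.
Qed.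

Context (V : lmodType R) (B : V -> V -> R) (hB : psd_form B).
Implicit Types b c : 'I_n -> V.

(* Decoupling: a uniformly random [I] separates a given pair [i != j] as
   [i \in I], [j \notin I] with probability 1/4. *)
Lemma split_offdiag b c :
  \sum_i \sum_(j | j != i) B (b i) (c j) =
  4 * (N^-1 * \sum_(I : {set 'I_n}) B (\sum_(i in I) b i) (\sum_(j in ~: I) c j)).
Proof.
have N0 : N != 0 by rewrite pnatr_eq0 expn_eq0.
have -> : \sum_(I : {set 'I_n}) B (\sum_(i in I) b i) (\sum_(j in ~: I) c j) =
  \sum_i \sum_j B (b i) (c j) * \sum_(I : {set 'I_n}) ((i \in I)%:R * (j \notin I)%:R).
  under eq_bigr do rewrite (psd_suml hB).
  under eq_bigr do (rewrite big_mkcond; under eq_bigr do rewrite (psd_sumr hB)).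
  rewrite exchange_big/=; apply: eq_bigr => i _.
  transitivity (\sum_(I : {set 'I_n}) \sum_j B (b i) (c j) * ((i \in I)%:R * (j \notin I)%:R)).
    apply: eq_bigr => I _; rewrite big_mkcond; case: (i \in I) => /=.
      apply: eq_bigr => j _; rewrite inE mul1r.
      by case: (j \notin I); rewrite ?mulr1 ?mulr0.
    by rewrite big1// => j _; rewrite mul0r mulr0.
  by rewrite exchange_big/=; apply: eq_bigr => j _; rewrite mulr_sumr.
rewrite mulrCA mulr_sumr mulr_sumr; apply: eq_bigr => i _.
rewrite [in RHS](bigD1 i)//= [in RHS]big1 ?mulr0 ?add0r; last first.
  by move=> I _; case: (i \in I); rewrite /= ?mulr0 ?mul0r.
rewrite !mulr_sumr; apply: eq_bigr => j ji.
rewrite (mulrCA 4) sum_indicator_split 1?eq_sym// mulrCA mulVf// mulr1//.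
Qed.

(** Two distinct indices both fall in a random [I] with probability 1/4, a single index with
    probability 1/2; the excess 1/4 on the diagonal is the second summand. *)
Lemma split_norm b :
  N^-1 * \sum_(I : {set 'I_n}) B (\sum_(i in I) b i) (\sum_(i in I) b i) =
  (B (\sum_i b i) (\sum_i b i) + \sum_i B (b i) (b i)) / 4.
Proof.
have N0 : N != 0 by rewrite pnatr_eq0 expn_eq0.
have -> : \sum_(I : {set 'I_n}) B (\sum_(i in I) b i) (\sum_(i in I) b i) =
  \sum_i \sum_j B (b i) (b j) * \sum_(I : {set 'I_n}) ((i \in I)%:R * (j \in I)%:R).
  under eq_bigr do rewrite (psd_suml hB).
  under eq_bigr do (rewrite big_mkcond; under eq_bigr do rewrite (psd_sumr hB)).
  rewrite exchange_big/=; apply: eq_bigr => i _.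
  transitivity (\sum_(I : {set 'I_n}) \sum_j B (b i) (b j) * ((i \in I)%:R * (j \in I)%:R)).
    apply: eq_bigr => I _; rewrite big_mkcond; case: (i \in I) => /=.
      apply: eq_bigr => j _; rewrite mul1r.
      by case: (j \in I); rewrite ?mulr1 ?mulr0.
    by rewrite big1// => j _; rewrite mul0r mulr0.
  by rewrite exchange_big/=; apply: eq_bigr => j _; rewrite mulr_sumr.
rewrite (psd_suml hB) -big_split/= mulr_suml mulr_sumr; apply: eq_bigr => i _.
rewrite (psd_sumr hB) (bigD1 i)//= [in RHS](bigD1 i)//= mulrDr.
have -> : \sum_(I : {set 'I_n}) ((i \in I)%:R * (i \in I)%:R) = N / 2.
  rewrite -(sum_indicator_diag i) mulrC mulKf ?pnatr_eq0//.
  by apply: eq_bigr => I _; case: (i \in I); rewrite ?mulr1 ?mulr0.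
have -> : \sum_(j | j != i) B (b i) (b j) * \sum_(I : {set 'I_n}) ((i \in I)%:R * (j \in I)%:R) =
    (\sum_(j | j != i) B (b i) (b j)) * (N / 4).
  rewrite mulr_suml; apply: eq_bigr => j ji.
  by rewrite -(sum_indicator_pair (_ : i != j)) 1?eq_sym// mulrC mulrAC divff ?mul1r ?pnatr_eq0// mulrC.
by field.
Qed.

End random_splitting.

(** * Deterministic part of the oracle inequality *)

Section selection.
Context (R : realFieldType) (V : lmodType R) (B : V -> V -> R).
Hypothesis hB : psd_form B.
Context (n : nat).
Hypothesis n0 : (0 < n)%N.

Definition emp_mean (a : 'I_n -> V) : V := n%:R^-1 *: \sum_i a i.

Definition partial_sum (a : 'I_n -> V) (s : V) (I : {set 'I_n}) : V :=
  \sum_(i in I) (a i - s).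

Definition emp_noise (a : 'I_n -> V) (s : V) : V :=
  n%:R^-1 *: \sum_i (a i - s).

(* By [criterion_expand], the criterion is the loss minus twice [ideal_pen], up
   to a term that does not depend on [a]. The last summand does not depend on [a]
   either; it is there to turn [B sK (emp_noise a0 s0)], coming from the diagonal
   terms of the penalty, into [B (sK - s) (emp_noise a0 s0)]. *)
Definition ideal_pen (a a0 : 'I_n -> V) (s0 s : V) : R :=
  B (emp_mean a - s) (emp_mean a0 - s)
  - n%:R ^- 2 * \sum_i B (a i) (a0 i) + n%:R^-1 * B s (emp_noise a0 s0).

(* All the fluctuation terms of the proof are controlled through these two
   weighted bounds, valid simultaneously for all [t > 0]. *)
Definition directional_bound (a : 'I_n -> V) (s u : V) (rho : R) :=
  forall t, 0 < t -> `|B u (emp_noise a s)| <= t * B u u + rho / t.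

Definition splitting_bound (a a' : 'I_n -> V) (s s' : V) (rho : R) :=
  forall t, 0 < t ->
  (2 ^ n)%:R^-1 * \sum_(I : {set 'I_n})
    `|B (partial_sum a s I) (partial_sum a' s' (~: I))| <=
  t * ((2 ^ n)%:R^-1 * \sum_(I : {set 'I_n})
    B (partial_sum a s I) (partial_sum a s I)) + n%:R ^+ 2 * (rho / t).

Let nR : n%:R != 0 :> R. Proof. by rewrite pnatr_eq0 -lt0n. Qed.

Let np : 0 < n%:R :> R. Proof. by rewrite ltr0n. Qed.

Lemma emp_meanE a s : emp_mean a = emp_noise a s + s.
Proof.
rewrite /emp_mean /emp_noise sumrB sumr_const card_ord scalerBr -[s *+ n]scaler_nat.
by rewrite scalerA mulVf// scale1r subrK.
Qed.

(** Polarisation of the difference of the two errors. The penalty on the left accounts for the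
    diagonal sum subtracted inside [ideal_pen]. *)
Lemma criterion_expand a a0 s0 s :
  B (emp_mean a - emp_mean a0) (emp_mean a - emp_mean a0)
    + 2 * (n%:R ^- 2 * \sum_i B (a i) (a0 i)) =
  B (emp_mean a - s) (emp_mean a - s) - 2 * ideal_pen a a0 s0 s
    + (B (emp_mean a0 - s) (emp_mean a0 - s)
       + 2 * (n%:R^-1 * B s (emp_noise a0 s0))).
Proof.
have -> : emp_mean a - emp_mean a0 = (emp_mean a - s) - (emp_mean a0 - s).
  by rewrite opprB addrA subrK.
rewrite /ideal_pen; move: (emp_mean a - s) (emp_mean a0 - s) => u v.
by rewrite !(psdBl hB, psdBr hB) (psdC hB v u); ring.
Qed.

Definition offdiag (a a' : 'I_n -> V) (s s' : V) : R :=
  n%:R ^- 2 * \sum_i \sum_(j | j != i) B (a i - s) (a' j - s').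

Lemma emp_noise_form a a' s s' : B (emp_noise a s) (emp_noise a' s') =
  n%:R ^- 2 * B (\sum_i (a i - s)) (\sum_i (a' i - s')).
Proof. by rewrite /emp_noise (psdZl hB) (psdZr hB) mulrA -expr2 exprVn. Qed.

Lemma noise_prod a a' s s' :
  B (emp_noise a s) (emp_noise a' s') =
  offdiag a a' s s' + n%:R ^- 2 * \sum_i B (a i - s) (a' i - s').
Proof.
rewrite emp_noise_form /offdiag -mulrDr.
congr (_ * _); rewrite (psd_suml hB) -big_split/=; apply: eq_bigr => i _.
by rewrite (psd_sumr hB) (bigD1 i)//= addrC.
Qed.

(** The factor 4 of [split_offdiag] cancels the 1/4 of [split_norm] and survives only in front of
    [rho / t]. *)
Lemma offdiag_bound a a' s s' rho t : 0 < t -> splitting_bound a a' s s' rho ->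
  `|offdiag a a' s s'| <=
  t * (B (emp_noise a s) (emp_noise a s)
       + n%:R ^- 2 * \sum_i B (a i - s) (a i - s)) + 4 * (rho / t).
Proof.
move=> t0 /(_ _ t0).
rewrite (split_norm hB) /offdiag (split_offdiag hB) => H.
rewrite emp_noise_form -mulrDr.
rewrite normrM normrM [`|n%:R ^- 2|]ger0_norm ?invr_ge0 ?exprn_ge0//.
rewrite (@ger0_norm _ 4)// normrM [`|(2 ^ n)%:R^-1|]ger0_norm ?invr_ge0//.
have {}H : (2 ^ n)%:R^-1 * `|\sum_(I : {set 'I_n})
    B (partial_sum a s I) (partial_sum a' s' (~: I))| <=
    t * ((B (\sum_i (a i - s)) (\sum_i (a i - s))
      + \sum_i B (a i - s) (a i - s)) / 4) + n%:R ^+ 2 * (rho / t).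
  apply: le_trans H; rewrite ler_wpM2l ?invr_ge0//; exact: ler_norm_sum.
have := ler_wpM2l (_ : 0 <= n%:R ^- 2 * 4) H.
rewrite mulr_ge0 ?invr_ge0 ?exprn_ge0// => /(_ isT).
rewrite -mulrA => /le_trans; apply; rewrite le_eqVlt; apply/orP; left; apply/eqP.
by field; rewrite nR gt_eqF.
Qed.

(** Centring the diagonal sum produces the terms in [n%:R^-1]; all the rest, apart from [offdiag],
    is linear in a single noise or deterministic. *)
Lemma ideal_penE a a0 sK s0 s :
  ideal_pen a a0 s0 s = offdiag a a0 sK s0
  + (1 - n%:R^-1) * B (sK - s) (emp_noise a0 s0)
  + B (emp_noise a sK) (s0 - s) + B (sK - s) (s0 - s)
  - n%:R^-1 * (B (emp_noise a sK) s0 + B sK s0).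
Proof.
have := noise_prod a a0 sK s0.
have -> : \sum_i B (a i - sK) (a0 i - s0) = \sum_i B (a i) (a0 i)
    - n%:R * (B sK (emp_noise a0 s0) + B (emp_noise a sK) s0 + B sK s0).
  have E (x : 'I_n -> V) (u : V) : \sum_i x i = n%:R *: (emp_noise x u + u).
    by rewrite -emp_meanE /emp_mean scalerA mulfV// scale1r.
  under eq_bigr do rewrite !(psdBl hB, psdBr hB).
  rewrite !sumrB -(psd_suml hB) -(psd_sumr hB) (E a sK) (E a0 s0).
  rewrite !(psdZl hB, psdZr hB, psdDl hB, psdDr hB) sumr_const card_ord -mulr_natl.
  by ring.
rewrite mulrBr => H; have {H} -> : offdiag a a0 sK s0 = B (emp_noise a sK) (emp_noise a0 s0)
   - (n%:R ^- 2 * \sum_i B (a i) (a0 i) - n%:R ^- 2 *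
     (n%:R * (B sK (emp_noise a0 s0) + B (emp_noise a sK) s0 + B sK s0))).
  by rewrite H addrK.
rewrite /ideal_pen (emp_meanE a sK) (emp_meanE a0 s0) -!addrA.
rewrite !(psdDl hB, psdDr hB, psdNl hB, psdNr hB).
by field.
Qed.

(** The intermediate bounds involve [ga], [De] and the squared bias [e], none of which is the loss.
    [De_le] eliminates [De] in favour of [ga], then [Q_ge] bounds [ga] and [e] by the loss [Q]. *)
Lemma ideal_pen_bound a a0 sK s0 s rho m t : 0 <= rho -> 0 < t -> t <= 1 ->
  B sK sK <= m -> B s0 s0 <= m ->
  directional_bound a0 s0 (sK - s) rho -> directional_bound a sK (sK - s) rho ->
  splitting_bound a a0 sK s0 rho -> splitting_bound a a sK sK rho ->
  `|ideal_pen a a0 s0 s| <=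
    5 * (t * B (emp_mean a - s) (emp_mean a - s))
    + (63 * rho + B (s0 - s) (s0 - s) + 2 * (m / n%:R)) / t.
Proof.
move=> rho0 t0 t1 mK m0 D0 D S0 S.
set Q := B (emp_mean a - s) (emp_mean a - s).
set de := B (s0 - s) (s0 - s).
pose g := emp_noise a sK; pose ga := B g g; pose e := B (sK - s) (sK - s).
pose De := n%:R ^- 2 * \sum_i B (a i - sK) (a i - sK).
have tV1 : 1 <= t^-1 by rewrite invf_ge1.
have de0 : 0 <= de by exact: (psd_ge0 hB).
have e0 : 0 <= e by exact: (psd_ge0 hB).
have ga0 : 0 <= ga by exact: (psd_ge0 hB).
have mp : 0 <= m by apply: le_trans mK; exact: (psd_ge0 hB).
have mn0 : 0 <= m / n%:R by rewrite divr_ge0// ltW.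
have QE : Q = ga + 2 * B (sK - s) g + e.
  rewrite /Q (emp_meanE a sK) -/g -addrA /ga /e; move: (sK - s) => w.
  by rewrite !(psdDl hB, psdDr hB) (psdC hB g w); ring.
have DeE : ga = offdiag a a sK sK + De by exact: noise_prod.
(* With weight 1/3, [DeE] gives De <= ga + (ga + De) / 3 + 12 rho, which is solved for De. *)
have De_le : De <= 2 * ga + 18 * rho.
  have := offdiag_bound (_ : 0 < 3^-1) S; rewrite invr_gt0 ltr0n => /(_ isT).
  rewrite -/g -/ga -/De invrK; have := ler_norm (- offdiag a a sK sK).
  rewrite normrN; lra.
(* With weight 1/4, the cross term of [QE] costs at most e / 2 + 8 rho. *)
have Q_ge : ga + e / 2 <= Q + 8 * rho.
  have := D 4^-1; rewrite invr_gt0 ltr0n => /(_ isT); rewrite -/g -/e invrK QE.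
  have := ler_norm (- B (sK - s) g); rewrite normrN; lra.
have U_le := offdiag_bound t0 S0; rewrite -/g -/ga -/De in U_le.
have D_le := D0 t t0; rewrite -/e in D_le.
have t2 : 0 < 2 * t by rewrite mulr_gt0.
have Y1 := psd_young hB g (s0 - s) t2; rewrite -/ga -/de invfM in Y1.
have Y2 := psd_young hB (sK - s) (s0 - s) t2; rewrite -/e -/de invfM in Y2.
have Y3 : n%:R^-1 * `|B g s0| <= t * ga + 4^-1 * (m / n%:R / t).
  have tn : 0 < 2 * t * n%:R by rewrite mulr_gt0.
  have := psd_young hB g s0 tn; rewrite -/ga => H.
  have {}H : 2 * `|B g s0| <= 2 * t * n%:R * ga + (2 * t * n%:R)^-1 * m.
    by apply: le_trans H _; rewrite lerD2l ler_pM2l ?invr_gt0.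
  have {}H : n%:R^-1 * `|B g s0| <= t * ga + 4^-1 * (m / n%:R / t) / n%:R.
    rewrite -(ler_pM2l np) mulVKf// -(ler_pM2l (_ : 0 < 2))//.
    apply: le_trans H _; rewrite le_eqVlt; apply/orP; left; apply/eqP.
    by field; rewrite nR gt_eqF.
  apply: le_trans H _; rewrite lerD2l ler_piMr ?invf_le1 ?ler1n//.
  by rewrite mulr_ge0 ?divr_ge0 ?invr_ge0 // ltW.
have Y4 : n%:R^-1 * `|B sK s0| <= m / n%:R.
  rewrite mulrC ler_wpM2r ?invr_ge0 ?ler0n//.
  have := psd_young hB sK s0 ltr01; rewrite invr1 !mul1r; lra.
rewrite (ideal_penE a a0 sK s0 s) -/g.
apply: (@le_trans _ _ (`|offdiag a a0 sK s0| + `|B (sK - s) (emp_noise a0 s0)|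
  + `|B g (s0 - s)| + `|B (sK - s) (s0 - s)|
  + (n%:R^-1 * `|B g s0| + n%:R^-1 * `|B sK s0|))).
  apply: le_trans (ler_normB _ _) _; apply: lerD.
    apply: le_trans (ler_normD _ _) _; rewrite lerD2r.
    apply: le_trans (ler_normD _ _) _; rewrite lerD2r.
    apply: le_trans (ler_normD _ _) _; rewrite lerD2l normrM ler_piMl//.
    rewrite ger0_norm; first by rewrite gerBl invr_ge0.
    by rewrite subr_ge0 invf_le1 ?ler1n.
  rewrite normrM ger0_norm ?invr_ge0 ?ler0n// -mulrDr.
  by rewrite ler_wpM2l ?invr_ge0 ?ler0n// ler_normD.
have tDe : t * De <= 2 * (t * ga) + 18 * (rho / t).
  have : t * De <= t * (2 * ga + 18 * rho) by rewrite ler_pM2l.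
  have : t * rho <= rho / t by rewrite mulrC ler_wpM2l// (le_trans t1).
  by rewrite mulrDr !(mulrCA t); lra.
(* The separate bounds add up to 5 t ga + 2 t e + 23 rho / t, up to the terms in [de] and [m]. Five
   copies of this inequality turn that into 5 t Q + 63 rho / t. *)
have tQ : t * ga + (t * e) / 2 <= t * Q + 8 * (rho / t).
  have : t * (ga + e / 2) <= t * (Q + 8 * rho) by rewrite ler_pM2l.
  have : t * rho <= rho / t by rewrite mulrC ler_wpM2l// (le_trans t1).
  by rewrite !mulrDr !(mulrCA t) !mulrA; lra.
have mt : m / n%:R <= m / n%:R / t by rewrite ler_peMr.
have dt0 : 0 <= de / t by rewrite divr_ge0// ltW.
have te0 : 0 <= t * e by rewrite mulr_ge0// ltW.
have tga0 : 0 <= t * ga by rewrite mulr_ge0// ltW.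
rewrite mulrDr in U_le.
have Y1' : 2 * `|B g (s0 - s)| <= 2 * (t * ga) + 2^-1 * (de / t).
  by apply: le_trans Y1 _; rewrite -!mulrA (mulrC t^-1).
have Y2' : 2 * `|B (sK - s) (s0 - s)| <= 2 * (t * e) + 2^-1 * (de / t).
  by apply: le_trans Y2 _; rewrite -!mulrA (mulrC t^-1).
rewrite !mulrDl -!(mulrA _ _ t^-1).
move: (rho / t) (de / t) (t * ga) (t * e) (t * Q) (t * De) U_le D_le Y1' Y2' Y3 tDe tQ dt0 te0 tga0 mt Y4 mn0.
rewrite -!(mulrA m).
move: (m / n%:R) (m * (n%:R^-1 / t)) => *.
lra.
Qed.

(** The weight [th / 30] leaves (1 - th/3) Q' <= (1 + th/3) Q + 120 X / th. For th < 1, dividing by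
    1 - th/3 replaces 1 + th/3 by at most 1 + th and 120 by at most 180. *)
Lemma selection_inequality (Q Q' psi psi' X c th : R) :
  0 < th -> th < 1 -> 0 <= Q -> 0 <= X ->
  `|psi| <= 5 * (th / 30 * Q) + X / (th / 30) ->
  `|psi'| <= 5 * (th / 30 * Q') + X / (th / 30) ->
  Q' - 2 * psi' + c <= Q - 2 * psi + c ->
  Q' <= (1 + th) * Q + 180 * (X / th).
Proof.
move=> th0 th1 Q0 X0 H H' L.
have XE : X / (th / 30) = 30 * (X / th) by field; rewrite gt_eqF.
have Y0 : 0 <= X / th by rewrite divr_ge0// ltW.
rewrite XE in H H'; set Y := X / th in H H' Y0 *.
have h1 := ler_norm psi'; have := ler_norm (- psi); rewrite normrN => h2.
have {}L : (1 - th / 3) * Q' <= (1 + th / 3) * Q + 120 * Y by lra.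
have p0 : 0 < 1 - th / 3 by lra.
rewrite -(ler_pM2l p0); apply: le_trans L _.
have H1 : 0 <= th * (1 - th) * Q by rewrite mulr_ge0// mulr_ge0 ?subr_ge0// ltW.
have H2 : 0 <= (1 - th) * Y by rewrite mulr_ge0// subr_ge0 ltW.
rewrite -subr_ge0; set rhs := (X in 0 <= X).
suff -> : rhs = (th * (1 - th) * Q) / 3 + 60 * ((1 - th) * Y) by lra.
by rewrite /rhs; field.
Qed.

End selection.

(** * Independence by resampling one coordinate *)

Section resampling.
Context disp (Omega : measurableType disp) d' (T : measurableType d')
  (R : realType) (P : probability Omega R) (mu : probability T R) (n : nat)
  (Z : 'I_n -> {RV P >-> T}).

Definition replace (j : 'I_n) (z : n.-tuple T) (t : T) : n.-tuple T :=
  [tuple if i == j then t else tnth z i | i < n].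

Lemma measurable_replace j :
  measurable_fun setT (fun p : n.-tuple T * T => replace j p.1 p.2).
Proof.
apply/measurable_fun_tnthP => i.
rewrite (_ : _ \o _ = fun p : n.-tuple T * T => if i == j then p.2 else tnth p.1 i).
  case: eqP => _; first exact: measurable_snd.
  exact: (measurableT_comp (measurable_tnth i) measurable_fst).
by apply/funext => p /=; rewrite tnth_mktuple.
Qed.

Lemma measurable_sample : measurable_fun setT (sample Z).
Proof.
apply/measurable_fun_tnthP => i.
rewrite (_ : _ \o _ = Z i); first exact: measurable_funPT.
by apply/funext => w /=; rewrite tnth_mktuple.
Qed.

Definition tuple_box (F : 'I_n -> set T) : set (n.-tuple T) :=
  [set z | forall i, F i (tnth z i)].

Lemma measurable_tuple_boxes : @measurable _ (n.-tuple T) =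
  <<s [set tuple_box F | F in [set F | forall i, measurable (F i)]] >>.
Proof.
apply/seteqP; split.
  apply: smallest_sub; first exact: smallest_sigma_algebra.
  rewrite -bigcup_seq => A [i _ [B mB <-]]; rewrite setTI.
  apply: sub_sigma_algebra; exists (fun k => if k == i then B else setT).
    by move=> k /=; case: eqP => // _; exact: measurableT.
  apply/seteqP; split => z /=; first by move/(_ i); rewrite eqxx.
  by move=> Bz k; case: eqP => // ->.
apply: smallest_sub; first exact: sigma_algebra_measurable.
move=> _ [F mF <-].
rewrite (_ : tuple_box F = \bigcap_(i in [set: 'I_n]) ((fun z => tnth z i) @^-1` F i)).
  apply: fin_bigcap_measurable => // i _; rewrite -[X in measurable X]setTI.
  exact: measurable_tnth.
by apply/seteqP; split => z /= h i => [_|]; exact: h.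
Qed.

Lemma measure_tuple_unique (m1 m2 : {measure set (n.-tuple T) -> \bar R}) :
  (m1 setT < +oo)%E ->
  (forall F, (forall i, measurable (F i)) ->
    m1 (tuple_box F) = m2 (tuple_box F)) ->
  forall A, measurable A -> m1 A = m2 A.
Proof.
move=> m1y m12 A mA.
apply: (measure_unique [set tuple_box F | F in [set F | forall i, measurable (F i)]]
  (fun=> setT)) => //.
- exact: measurable_tuple_boxes.
- move=> _ _ [F mF <-] [G mG <-]; exists (fun i => F i `&` G i).
    by move=> i; exact: measurableI.
  by apply/seteqP; split => z /=; [move=> h; split=> i; case: (h i)|case].
- by move=> _; exists (fun=> setT) => [i|]; [exact: measurableT|exact/seteqP].
- by rewrite bigcup_const.
- by move=> _ [F mF <-]; exact: m12.
Qed.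

Hypothesis Z_iid : iid_with_law mu Z.

Lemma sample_box (F : 'I_n -> set T) : (forall i, measurable (F i)) ->
  P (sample Z @^-1` tuple_box F) = (\prod_(i < n) mu (F i))%E.
Proof.
move=> mF; have [Zmu Zind] := Z_iid.
rewrite (_ : _ @^-1` _ = \bigcap_(i in [set` [set: 'I_n]%SET]) Z i @^-1` F i).
  rewrite Zind//; apply: eq_big => [i|i _]; first by rewrite inE.
  exact: Zmu.
apply/seteqP; split => w /= h i.
  by move=> _ /=; have := h i; rewrite tnth_mktuple.
by rewrite tnth_mktuple; apply: h; rewrite /= inE.
Qed.

(** This stands in for conditioning on all coordinates but the [j]-th. The sample under [P] and the
    modified sample under [P \x mu] have the same law because they agree on boxes. *)
Lemma resample j (Phi : n.-tuple T -> \bar R) :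
  measurable_fun setT Phi -> (forall z, 0 <= Phi z)%E ->
  (\int[P]_w Phi (sample Z w) =
   \int[P]_w \int[mu]_t Phi (replace j (sample Z w) t))%E.
Proof.
move=> mPhi Phi0.
pose S : {mfun Omega >-> n.-tuple T} :=
  HB.pack (sample Z) (isMeasurableFun.Build _ _ _ _ _ measurable_sample).
have mrS : measurable_fun setT (fun p : Omega * T => replace j (sample Z p.1) p.2).
  have m2 : measurable_fun setT (fun p : Omega * T => (sample Z p.1, p.2)).
    apply: measurable_fun_pair; last exact: measurable_snd.
    exact: (measurableT_comp measurable_sample measurable_fst).
  exact: (measurableT_comp (measurable_replace j) m2).
pose rS : {mfun (Omega * T)%type >-> n.-tuple T} :=
  HB.pack (fun p : Omega * T => replace j (sample Z p.1) p.2)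
    (isMeasurableFun.Build _ _ _ _ _ mrS).
have H A : measurable A ->
    pushforward P S A = pushforward (P \x mu)%E rS A.
  apply: measure_tuple_unique.
    by rewrite /= /pushforward preimage_setT probability_setT ltry.
  move=> F mF; rewrite /= /pushforward /= sample_box//.
  (* The constraint on coordinate [j] moves from the sample to the fresh point. *)
  pose F' i := if i == j then setT else F i.
  have mF' i : measurable (F' i) by rewrite /F'; case: eqP.
  rewrite (_ : _ @^-1` tuple_box F = (sample Z @^-1` tuple_box F') `*` F j).
    rewrite product_measure1E//; last first.
      rewrite -[X in measurable X]setTI; apply: measurable_sample => //.
      by rewrite measurable_tuple_boxes; apply: sub_sigma_algebra; exists F'.
    rewrite [X in (X * _)%E]sample_box// (bigD1 j)//= [in RHS](bigD1 j)//=.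
    rewrite /F' eqxx probability_setT mul1e muleC; congr (_ * _)%E.
    by apply: eq_bigr => i /negbTE ->.
  apply/seteqP; split => -[w t] /=.
    move=> h; split; last by have := h j; rewrite tnth_mktuple eqxx.
    by move=> i; rewrite /F'; case: eqP => // /eqP/negbTE ij; have := h i;
      rewrite !tnth_mktuple ij.
  move=> [h Ft] i; rewrite tnth_mktuple; case: eqP => [->//|/eqP/negbTE ij].
  by have := h i; rewrite /F' ij.
transitivity (\int[pushforward P S]_z Phi z)%E.
  by rewrite ge0_integral_pushforward//; exact: measurable_sample.
transitivity (\int[pushforward (P \x mu)%E rS]_z Phi z)%E.
  by apply: eq_measure_integral => A mA _; exact: H.
rewrite ge0_integral_pushforward// preimage_setT fubini_tonelli1//.
  exact: measurableT_comp.
by move=> p; exact: Phi0.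
Qed.

(* Peeling off the coordinates in [s] one at a time with [resample]. *)
Lemma expectation_prod_le (s : seq 'I_n) (g : n.-tuple T * T -> R) (C : R) :
  uniq s -> 0 <= C -> measurable_fun setT g -> (forall p, 0 <= g p) ->
  (forall j z t t', j \in s -> g (replace j z t, t') = g (z, t')) ->
  (forall z, \int[mu]_t (g (z, t))%:E <= C%:E)%E ->
  (\int[P]_w (\prod_(j <- s) g (sample Z w, Z j w))%:E <= (C ^+ size s)%:E)%E.
Proof.
move=> us C0 mg g0 gs gC; elim: s us gs => [_ _|j s IH /= /andP[js us] gs].
  under eq_integral do rewrite big_nil.
  by rewrite integral_cst// mul1e; exact: probability_le1.
pose Phi (z : n.-tuple T) := (\prod_(i <- j :: s) g (z, tnth z i))%:E.
have mPhi : measurable_fun setT Phi.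
  apply/measurable_EFinP; apply: measurable_prod => i _.
  apply: (measurableT_comp mg); apply: measurable_fun_pair => //.
  exact: measurable_tnth.
have mG : measurable_fun setT
    (fun w => (\prod_(i <- s) g (sample Z w, Z i w))%:E).
  apply/measurable_EFinP; apply: measurable_prod => i _.
  apply: (measurableT_comp mg); apply: measurable_fun_pair => //.
  exact: measurable_sample.
have Phi0 z : (0 <= Phi z)%E by rewrite lee_fin prodr_ge0.
rewrite (_ : integral _ _ _ = \int[P]_w Phi (sample Z w))%E; last first.
  by apply: eq_integral => w _; congr EFin; apply: eq_bigr => i _; rewrite tnth_mktuple.
rewrite (resample j)//.
(* Only the head factor sees [t]: by uniqueness every [i] in the tail differs from [j], and [g]
   ignores coordinate [j] of its tuple. *)
have PhiE z t : Phi (replace j z t) =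
    ((\prod_(i <- s) g (z, tnth z i))%:E * (g (z, t))%:E)%E.
  rewrite /Phi big_cons gs ?mem_head// tnth_mktuple eqxx mulrC EFinM; congr (_ * _)%E.
  congr EFin; apply: eq_big_seq => i si; rewrite gs ?mem_head// tnth_mktuple.
  by case: eqP si js => // -> ->.
apply: (@le_trans _ _ (\int[P]_w ((\prod_(i <- s) g (sample Z w, Z i w))%:E * C%:E)%E)%E).
  apply: ge0_le_integral => //.
  - by move=> w _; apply: integral_ge0.
  - apply: (measurable_fun_fubini_tonelli_F
      (fun p : Omega * T => Phi (replace j (sample Z p.1) p.2))) => //.
    have m2 : measurable_fun setT (fun p : Omega * T => (sample Z p.1, p.2)).
      apply: measurable_fun_pair; last exact: measurable_snd.
      exact: (measurableT_comp measurable_sample measurable_fst).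
    exact: (measurableT_comp mPhi (measurableT_comp (measurable_replace j) m2)).
  - exact: emeasurable_funM.
  - move=> w _; under eq_integral do rewrite PhiE.
    rewrite ge0_integralZl//; first last.
    + by rewrite lee_fin prodr_ge0.
    + by move=> t _; rewrite lee_fin.
    + apply/measurable_EFinP; apply: (measurableT_comp mg).
      exact: measurable_fun_pair.
    under eq_bigr do rewrite tnth_mktuple.
    by apply: lee_wpmul2l => //; rewrite lee_fin prodr_ge0.
rewrite ge0_integralZr//; first last.
- by move=> w _; rewrite lee_fin prodr_ge0.
rewrite exprSr EFinM; apply: lee_wpmul2r; first by rewrite lee_fin.
apply: IH => // i z t t' si; apply: gs; by rewrite inE si orbT.
Qed.

Lemma expectation_coord i (phi : T -> \bar R) :
  measurable_fun setT phi -> (forall t, 0 <= phi t)%E ->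
  (\int[P]_w phi (Z i w) = \int[mu]_t phi t)%E.
Proof.
move=> mphi phi0; rewrite -(ge0_integral_distribution (Z i) mphi phi0).
by apply: eq_measure_integral => A mA _; have [Zmu _] := Z_iid; exact: Zmu.
Qed.

End resampling.

(** * The inner product of square-integrable functions *)

Section l2_space.
Context (R : realType) (d : nat).
Local Notation E := 'rV[R]_d.
Local Notation leb := (lebesgue_rV R d).
Local Notation L2 := (LfunType leb (lee1n (R := R) 2)).

Lemma l2norm_sq_integral (g : E -> R) :
  l2norm_sq g = (\int[leb]_x ((g x) ^+ 2)%:E)%E.
Proof.
rewrite /l2norm_sq unlock /Lnorm.
rewrite (_ : integral _ _ _ = \int[leb]_x ((g x) ^+ 2)%:E)%E; last first.
  by apply: eq_integral => x _ /=; rewrite powR_mulrn// real_normK// num_real.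
rewrite poweR12_sqrt ?sqr_sqrte//; apply: integral_ge0 => x _;
  by rewrite lee_fin sqr_ge0.
Qed.

Lemma l2norm_sq_ge0 (g : E -> R) : (0 <= l2norm_sq g)%E.
Proof. by rewrite l2norm_sq_integral integral_ge0// => x _; rewrite lee_fin sqr_ge0. Qed.

Lemma Lfun2P (g : E -> R) : measurable_fun setT g -> (l2norm_sq g < +oo)%E ->
  g \in Lfun leb 2%:E.
Proof.
move=> mg; rewrite /l2norm_sq => gy; rewrite inE; apply/andP; split; rewrite inE//=.
rewrite /finite_norm; move: gy; case: (Lnorm _ _ _) => [r|//|//] _.
exact: ltry.
Qed.

Lemma l2norm_sqE (g : E -> R) : g \in Lfun leb 2%:E ->
  l2norm_sq g = (l2inner g g)%:E.
Proof.
move=> /Lfun2_integrable_sqr ig; rewrite l2norm_sq_integral /l2inner /Rintegral.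
rewrite (_ : (fun x => (g x * g x)%:E) = EFin \o (fun x => g x ^+ 2)).
  by rewrite fineK//; exact: integrable_fin_num.
by apply/funext => x /=; rewrite expr2.
Qed.

Lemma l2_integrable_mul (f g : L2) :
  leb.-integrable setT (fun x => (f x * g x)%:E).
Proof. by apply/Lfun1_integrable; apply: Lfun2_mul_Lfun1; exact: LfunP. Qed.

Definition ip (f g : L2) : R := l2inner f g.

Lemma ip_psd : psd_form ip.
Proof.
split=> [f g|a f g h|f].
- by apply: eq_Rintegral => x _; rewrite mulrC.
- rewrite /ip /l2inner -RintegralZl ?l2_integrable_mul// -RintegralD//.
  + by apply: eq_Rintegral => x _; rewrite mulrA -mulrDl.
  + exact: (integrableZl measurableT a (l2_integrable_mul f h)).
  + exact: l2_integrable_mul.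
- by apply: Rintegral_ge0 => x _; rewrite -expr2 sqr_ge0.
Qed.

(* Functions that are not square integrable are sent to [0]. *)
Definition to_L2 (g : E -> R) : L2 := insubd (0 : L2) g.

Lemma to_L2K g : g \in Lfun leb 2%:E -> to_L2 g = g :> (E -> R).
Proof. exact: insubdK. Qed.

Lemma L2_sumE n (F : 'I_n -> L2) x : (\sum_i F i) x = \sum_i F i x.
Proof. by apply: (big_morph (fun f : L2 => f x)). Qed.

End l2_space.

(** Tonelli applies separately to the positive and negative parts; infinite values of the difference
    are sent to 0 by [fine]. *)
Lemma measurable_fun_Rintegral d1 d2 (T1 : measurableType d1)
    (T2 : measurableType d2) (R : realType)
    (m2 : {sigma_finite_measure set T2 -> \bar R}) (f : T1 * T2 -> R) :
  measurable_fun setT f ->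
  measurable_fun setT (fun x => \int[m2]_y f (x, y)).
Proof.
move=> mf; rewrite /Rintegral.
apply: (measurableT_comp (fine_measurable measurableT)).
rewrite (_ : (fun x => _) = fun x =>
    \int[m2]_y ((EFin \o f)^\+ (x, y)) - \int[m2]_y ((EFin \o f)^\- (x, y)))%E.
  have mEf : measurable_fun setT (EFin \o f) by exact/measurable_EFinP.
  apply: emeasurable_funB.
    apply: (measurable_fun_fubini_tonelli_F (EFin \o f)^\+%E) => //.
    exact: measurable_funepos.
  apply: (measurable_fun_fubini_tonelli_F (EFin \o f)^\-%E) => //.
  exact: measurable_funeneg.
apply/funext => x; rewrite integralE; congr (_ - _)%E; apply: eq_integral => y _.
  by rewrite -[RHS]/(((EFin \o f)^\+ \o (fun y => (x, y))) y)%E -funepos_comp.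
by rewrite -[RHS]/(((EFin \o f)^\- \o (fun y => (x, y))) y)%E -funeneg_comp.
Qed.

(** * Kernels as vectors of L2, and the weak mean of K(X,.) ell(Y) *)

Section kernel_l2.
Context (R : realType) (d : nat).
Local Notation E := 'rV[R]_d.
Local Notation leb := (lebesgue_rV R d).
Local Notation L2 := (LfunType leb (lee1n (R := R) 2)).
Context (mu : probability (E * R)%type R) (ell : R -> R).
Hypothesis ell_meas : measurable_fun [set: R] ell.
Hypothesis ell_int : mu.-integrable setT (fun z => (ell z.2)%:E).

(* [kv K x], [av K (x, y)] and [sv K] are K(x,.), K(x,.) ell(y) and s_{K,ell}
   as elements of L2. *)
Definition kv (K : E -> E -> R) (x : E) : L2 := to_L2 (K x).
Definition av (K : E -> E -> R) (z : E * R) : L2 := ell z.2 *: kv K z.1.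
Definition sv (K : E -> E -> R) : L2 := to_L2 (mean_estimator mu ell K).

(** Conditions (1), (2) and (4) for a single kernel, plus measurability; [c] is later [m * n%:R]. *)
Record regular_kernel (c m : R) (K : E -> E -> R) : Prop := {
  rk_meas : measurable_fun setT (fun p : E * E => K p.1 p.2) ;
  rk_norm : forall x, (l2norm_sq (K x) <= c%:E)%E ;
  rk_mean : (l2norm_sq (mean_estimator mu ell K) <= m%:E)%E ;
  rk_weak : forall u : L2,
    (\int[mu]_z ((ip u (kv K z.1)) ^+ 2)%:E <= (m * ip u u)%:E)%E }.

Section one_kernel.
Context (c m : R) (K : E -> E -> R).
Hypothesis hK : regular_kernel c m K.

Lemma kernel_Lfun x : K x \in Lfun leb 2%:E.
Proof.
apply: Lfun2P; last by rewrite (le_lt_trans (rk_norm hK x)) ?ltry.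
rewrite -[K x]/((fun p : E * E => K p.1 p.2) \o (fun y => (x, y))).
by apply: measurableT_comp; [exact: rk_meas hK|exact: measurable_fun_pair].
Qed.

Lemma kvE x : kv K x = K x :> (E -> R).
Proof. exact/to_L2K/kernel_Lfun. Qed.

Lemma ip_kv_le x : ip (kv K x) (kv K x) <= c.
Proof.
rewrite -lee_fin; apply: le_trans (rk_norm hK x).
by rewrite l2norm_sqE ?kernel_Lfun// /ip kvE.
Qed.

Lemma measurable_mean_estimator : measurable_fun setT (mean_estimator mu ell K).
Proof.
apply: (measurable_fun_Rintegral mu (f := fun p : E * (E * R) => K p.2.1 p.1 * ell p.2.2)).
apply: measurable_funM.
  have m2 : measurable_fun setT (fun p : E * (E * R) => (p.2.1, p.1)).
    apply: measurable_fun_pair => //.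
    exact: (measurableT_comp measurable_fst measurable_snd).
  exact: (measurableT_comp (rk_meas hK) m2).
apply: (measurableT_comp ell_meas).
exact: (measurableT_comp measurable_snd measurable_snd).
Qed.

Lemma mean_Lfun : mean_estimator mu ell K \in Lfun leb 2%:E.
Proof.
apply: Lfun2P; first exact: measurable_mean_estimator.
by rewrite (le_lt_trans (rk_mean hK)) ?ltry.
Qed.

Lemma svE : sv K = mean_estimator mu ell K :> (E -> R).
Proof. exact/to_L2K/mean_Lfun. Qed.

Lemma ip_sv_le : ip (sv K) (sv K) <= m.
Proof.
rewrite -lee_fin; apply: le_trans (rk_mean hK).
by rewrite l2norm_sqE ?mean_Lfun// /ip svE.
Qed.

Lemma measurable_L2 (u : L2) : measurable_fun setT u.
Proof. exact: measurable_funPT. Qed.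

Lemma measurable_ip_kv (u : L2) : measurable_fun setT (fun x => ip u (kv K x)).
Proof.
rewrite (_ : (fun x => _) = fun x => \int[leb]_t (u t * K x t)); last first.
  by apply/funext => x; rewrite /ip kvE.
apply: (measurable_fun_Rintegral leb (f := fun p : E * E => u p.2 * K p.1 p.2)).
apply: measurable_funM; last exact: rk_meas hK.
exact: (measurableT_comp (measurable_L2 u) measurable_snd).
Qed.

Lemma ip_EFin (u v : L2) : (\int[leb]_t (u t * v t)%:E = (ip u v)%:E)%E.
Proof.
by rewrite /ip /l2inner /Rintegral fineK//; exact/integrable_fin_num/l2_integrable_mul.
Qed.

(** The mean of the estimator is defined pointwise; Fubini makes it also the weak mean, so that the
    terms K(X_i,.) ell(Y_i) - s_K are centred in every direction. *)
Lemma ip_mean (u : L2) :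
  mu.-integrable setT (fun z => (ip u (av K z))%:E) /\
  (\int[mu]_z (ip u (av K z))%:E = (ip u (sv K))%:E)%E.
Proof.
pose F (p : (E * R) * E) : \bar R := (u p.2 * (K p.1.1 p.2 * ell p.1.2))%:E.
have mF : measurable_fun setT F.
  apply/measurable_EFinP; apply: measurable_funM.
    exact: (measurableT_comp (measurable_L2 u) measurable_snd).
  apply: measurable_funM.
    have m2 : measurable_fun setT (fun p : (E * R) * E => (p.1.1, p.2)).
      apply: measurable_fun_pair => //.
      exact: (measurableT_comp measurable_fst measurable_fst).
    exact: (measurableT_comp (rk_meas hK) m2).
  apply: (measurableT_comp ell_meas).
  exact: (measurableT_comp measurable_snd measurable_fst).
have FE z : (\int[leb]_t F (z, t) = (ip u (av K z))%:E)%E.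
  rewrite -ip_EFin; apply: eq_integral => t _; rewrite /F/=; congr EFin.
  by rewrite [RHS](_ : _ = u t * (ell z.2 * kv K z.1 t))// kvE; ring.
have iF : (mu \x leb)%E.-integrable setT F.
  apply/integrable12ltyP => //.
  (* Domination by |u K ell| <= |ell| (u^2 + K^2), the integral of K^2 being at most [c] uniformly
     in the first argument. *)
  apply: (@le_lt_trans _ _ (\int[mu]_z (`|ell z.2|%:E * (ip u u + c)%:E))%E).
    apply: ge0_le_integral => //.
    - by move=> z _; exact: integral_ge0.
    - apply: (measurable_fun_fubini_tonelli_F (abse \o F)) => //.
        exact: measurableT_comp.
      by move=> p; exact: abse_ge0.
    - apply: emeasurable_funM => //; apply/measurable_EFinP.
      apply: measurableT_comp => //.
      exact: (measurableT_comp ell_meas measurable_snd).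
    - move=> z _.
      apply: (@le_trans _ _ (\int[leb]_t (`|ell z.2|%:E *
          ((u t * u t)%:E + (kv K z.1 t * kv K z.1 t)%:E)))%E).
        apply: ge0_le_integral => //.
        + apply: measurableT_comp => //.
          exact: (measurableT_comp mF (measurable_fun_pair _ _)).
        + by apply: emeasurable_funM => //; apply: emeasurable_funD;
            apply/measurable_EFinP; apply: measurable_funM; exact: measurable_L2.
        + move=> t _; rewrite /F/= lee_fin kvE !normrM mulrA mulrC ler_wpM2l//.
          move: (u t) (K z.1 t) => a b; have := sqr_ge0 (`|a| - `|b|).
          rewrite sqrrB !real_normK ?num_real// !expr2 mulr2n.
          have := mulr_ge0 (normr_ge0 a) (normr_ge0 b); lra.
      rewrite ge0_integralZl//; first last.
      + by move=> t _; rewrite -EFinD lee_fin addr_ge0// -expr2 sqr_ge0.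
      + by apply: emeasurable_funD; apply/measurable_EFinP; apply: measurable_funM;
          exact: measurable_L2.
      rewrite ge0_integralD//; first last.
      + by apply/measurable_EFinP; apply: measurable_funM; exact: measurable_L2.
      + by move=> t _; rewrite lee_fin -expr2 sqr_ge0.
      + by apply/measurable_EFinP; apply: measurable_funM; exact: measurable_L2.
      + by move=> t _; rewrite lee_fin -expr2 sqr_ge0.
      rewrite !ip_EFin lee_wpmul2l ?lee_fin// lerD2l; exact: ip_kv_le.
  rewrite ge0_integralZr//; first last.
  - rewrite lee_fin addr_ge0 ?(psd_ge0 (ip_psd _ _))//.
    by apply: le_trans (ip_kv_le 0); exact: (psd_ge0 (ip_psd _ _)).
  - apply/measurable_EFinP; apply: measurableT_comp => //.
    exact: (measurableT_comp ell_meas measurable_snd).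
  have ell_fin : (\int[mu]_z `|ell z.2|%:E < +oo)%E by case/integrableP : ell_int.
  by rewrite lte_mul_pinfty ?integral_ge0// ?ge0_fin_numE ?integral_ge0// ltry.
split.
  rewrite (_ : (fun z => _) = fubini_F leb F); first exact: integrable_fubini_F.
  by apply/funext => z; rewrite -FE.
transitivity (\int[mu]_z \int[leb]_t F (z, t))%E.
  by apply: eq_integral => z _; rewrite FE.
rewrite (Fubini iF) -ip_EFin svE.
apply: ae_eq_integral => //.
- exact: (measurable_fubini_G iF).
- apply/measurable_EFinP; apply: measurable_funM; first exact: measurable_L2.
  exact: measurable_mean_estimator.
apply: filterS (ae_integrable2 iF) => t iFt _; rewrite /F/=.
(* Fubini only yields integrability of the section multiplied by [u t]: both sides vanish where
   [u t = 0], and elsewhere one divides by it. *)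
have [ut0|utn0] := eqVneq (u t) 0.
  by under eq_integral do rewrite ut0 mul0r; rewrite integral0 ut0 mul0r.
have iK : mu.-integrable setT (fun z => (K z.1 t * ell z.2)%:E).
  rewrite (_ : (fun z => _) = fun z => ((u t)^-1%:E * F (z, t))%E).
    exact: integrableZl.
  by apply/funext => z; rewrite /F/= -EFinM mulKf.
under eq_integral do rewrite EFinM.
rewrite integralZl// EFinM; congr (_ * _)%E.
by rewrite /mean_estimator /Rintegral fineK//; exact: integrable_fin_num.
Qed.

End one_kernel.
End kernel_l2.

Lemma integral_prob_cst d (T : measurableType d) (R : realType)
    (P : probability T R) (k : R) :
  (\int[P]_x k%:E = k%:E)%E.
Proof.
rewrite integral_cst//; transitivity (k%:E * 1)%E; last by rewrite mule1.
by congr (_ * _)%E; exact: probability_setT.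
Qed.

(** * Exponential moments *)

Section real_bounds.
Context (R : realType).

(** From 1 - x/2 <= exp(-x/2) one gets exp(x) <= (1 - x/2)^-2, which reduces the claim to the sign
    of a polynomial that factorises. *)
Lemma expR_le_quadratic (x : R) : x <= 1 -> expR x <= 1 + x + 2 * x ^+ 2.
Proof.
move=> x1; have h : 0 < 1 - x / 2 by lra.
have e0 := expR_gt0 (- (x / 2)).
have : 1 - x / 2 <= expR (- (x / 2)) by exact: expR_ge1Dx.
rewrite -lef_pV2 ?posrE// -expRN opprK => H.
have E : expR x = expR (x / 2) ^+ 2.
  by rewrite -expRM_natr; congr expR; field.
have {}H : expR x <= (1 - x / 2)^-1 ^+ 2.
  by rewrite E lerXn2r ?nnegrE ?expR_ge0 ?invr_ge0 ?(ltW h).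
apply: le_trans H _; rewrite exprVn -div1r ler_pdivrMr ?exprn_gt0//.
rewrite -subr_ge0.
have -> : (1 + x + 2 * x ^+ 2) * (1 - x / 2) ^+ 2 - 1 =
  x ^+ 2 * ((1 - x) * (5 - 2 * x)) / 4 by field.
by rewrite divr_ge0// mulr_ge0 ?sqr_ge0// mulr_ge0//; lra.
Qed.

Lemma le_expR (x : R) : x <= expR x.
Proof. by apply: le_trans (expR_ge1Dx x); rewrite lerDr. Qed.

Lemma expR_norm_le (x : R) : expR `|x| <= expR x + expR (- x).
Proof. by case: ger0P => _; [rewrite lerDl|rewrite lerDr]; exact: expR_ge0. Qed.

(** For t <= x the first term suffices. Otherwise put y = t - x, so that (x + y)^2 <= 2 x^2 + 2 y^2
    and y^2 / 2 <= exp(y). *)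
Lemma sqr_le_expR (x t : R) : 0 <= x -> 0 <= t ->
  t ^+ 2 <= 2 * x ^+ 2 + 4 * (expR (- x) * expR t).
Proof.
move=> x0 t0; rewrite -expRD.
have [tx|xt] := leP t x.
  have : t ^+ 2 <= x ^+ 2 by rewrite lerXn2r.
  have := expR_ge0 (- x + t); have := sqr_ge0 x; lra.
have tx0 : 0 <= - x + t by lra.
have := @expR_ge1Dxn R _ 1 tx0; rewrite (_ : 2`! = 2)//.
have := sqr_ge0 (2 * x - t).
rewrite (_ : t ^+ 2 = ((- x + t) + x) ^+ 2); last by congr (_ ^+ 2); ring.
have := sqr_ge0 ((- x + t) - x); move: (- x + t) => y.
by rewrite !expr2; lra.
Qed.

(* [isqrt 0 = 0], so that normalising the zero vector gives the zero vector. *)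
Definition isqrt (a : R) : R := a `^ (- 2^-1).

Lemma isqrt_ge0 a : 0 <= isqrt a.
Proof. exact: powR_ge0. Qed.

Lemma isqrt_sqr a : 0 < a -> isqrt a ^+ 2 = a^-1.
Proof.
move=> a0; rewrite /isqrt -powR_mulrn ?powR_ge0// -powRrM mulNr mulVf ?pnatr_eq0//.
by rewrite powR_inv1// ltW.
Qed.

Lemma isqrt_sqr_le1 a : 0 <= a -> isqrt a ^+ 2 * a <= 1.
Proof.
rewrite le_eqVlt => /predU1P[<-|a0]; first by rewrite mulr0.
by rewrite isqrt_sqr// mulVf// gt_eqF.
Qed.

Lemma measurable_isqrt : measurable_fun setT isqrt.
Proof. exact: measurable_powR. Qed.

(** This is |y| <= t a + y^2 / (4 t a); [kappa] cancels and only displays the normalised quantity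
    that has an exponential moment. When a = 0, the hypothesis forces y = 0. *)
Lemma norm_le_isqrt (kappa t a b y : R) : 0 < kappa -> 0 < t -> 0 <= a ->
  y ^+ 2 <= a * b ->
  `|y| <= t * a + (kappa * (isqrt a * `|y|)) ^+ 2 / (4 * kappa ^+ 2) / t.
Proof.
move=> k0 t0; rewrite le_eqVlt => /predU1P[<-|a0] yab.
  rewrite mul0r in yab; have /eqP : y ^+ 2 = 0 by apply/eqP; rewrite eq_le yab sqr_ge0.
  by rewrite sqrf_eq0 => /eqP ->; rewrite normr0 !mulr0 expr0n/= !mul0r addr0.
rewrite exprMn exprMn isqrt_sqr// real_normK ?num_real//.
have -> : kappa ^+ 2 * (a^-1 * y ^+ 2) / (4 * kappa ^+ 2) / t = y ^+ 2 / (4 * (t * a)).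
  by field; rewrite !gt_eqF.
have ta : 0 < t * a by rewrite mulr_gt0.
have := sqr_ge0 (2 * (t * a) - `|y|).
rewrite -subr_ge0 => H; rewrite -subr_ge0.
have -> : t * a + y ^+ 2 / (4 * (t * a)) - `|y| =
  (2 * (t * a) - `|y|) ^+ 2 / (4 * (t * a)).
  have <- : `|y| ^+ 2 = y ^+ 2 by rewrite real_normK ?num_real.
  by field; rewrite !gt_eqF.
by rewrite divr_ge0 ?sqr_ge0// mulr_ge0// ltW.
Qed.

End real_bounds.

Section mean_le.
Context d (T : measurableType d) (R : realType) (P : probability T R).
Implicit Types (f g : T -> R) (a b c : R).

(** Measurability and sign travel with the bound, so that sums and multiples of such functions need
    no further side conditions. *)
Definition mean_le f a := [/\ measurable_fun setT f, forall w, 0 <= f w &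
  (\int[P]_w (f w)%:E <= a%:E)%E].

Lemma mean_le_cst c : 0 <= c -> mean_le (fun=> c) c.
Proof. by move=> c0; split=> //; rewrite integral_prob_cst. Qed.

Lemma mean_leD f g a b : mean_le f a -> mean_le g b ->
  mean_le (fun w => f w + g w) (a + b).
Proof.
move=> [mf f0 fa] [mg g0 gb]; split; first exact: measurable_funD.
  by move=> w; rewrite addr_ge0.
under eq_integral do rewrite EFinD.
rewrite ge0_integralD//; [by rewrite EFinD leeD|..].
- by move=> w _; rewrite lee_fin.
- exact/measurable_EFinP.
- by move=> w _; rewrite lee_fin.
- exact/measurable_EFinP.
Qed.

Lemma mean_leZ c f a : 0 <= c -> mean_le f a -> mean_le (fun w => c * f w) (c * a).
Proof.
move=> c0 [mf f0 fa]; split; first exact: measurable_funM.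
  by move=> w; rewrite mulr_ge0.
under eq_integral do rewrite EFinM.
rewrite ge0_integralZl//; [by rewrite EFinM lee_wpmul2l// lee_fin|..].
- exact/measurable_EFinP.
- by move=> w _; rewrite lee_fin.
Qed.

Lemma mean_le_sum (I : finType) (F : I -> T -> R) a :
  (forall i, mean_le (F i) a) ->
  mean_le (fun w => \sum_i F i w) (#|I|%:R * a).
Proof.
move=> Fa; split.
- by apply: measurable_sum => i; have [] := Fa i.
- by move=> w; apply: sumr_ge0 => i _; have [] := Fa i.
under eq_integral do rewrite -sumEFin.
rewrite ge0_integral_sum//.
- rewrite mulr_natl -sumr_const -sumEFin; apply: lee_sum => i _.
  by have [] := Fa i.
- by move=> i; apply/measurable_EFinP; have [] := Fa i.
- by move=> i w _; rewrite lee_fin; have [_ + _] := Fa i; exact.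
Qed.

End mean_le.

(** * From exponential statistics to the weighted bounds *)

Section exponential_control.
Context (R : realType) (V : lmodType R) (B : V -> V -> R) (hB : psd_form B).
Context (n : nat) (n0 : (0 < n)%N) (ka : R) (ka0 : 0 < ka).
Implicit Types (a : 'I_n -> V) (s u : V) (S : R).

(** The component of [v] along [u] normalised: when [u] is random, the exponential moment must not
    depend on its length. *)
Definition dir_stat u v : R := ka * (isqrt (B u u) * `|B u v|).

(** The numerator bounds [dir_stat] squared when its exponential is at most [n%:R * S], by
    [sqr_le_expR] at x = ln n. The factor [4 * ka ^+ 2] comes from [dir_statP], and [n%:R ^+ 2] from
    the normalisation of the sums. *)
Definition noise_level S : R := (2 * ln n%:R ^+ 2 + 4 * S) / (4 * ka ^+ 2) / n%:R ^+ 2.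

Let np : 0 < n%:R :> R. Proof. by rewrite ltr0n. Qed.

Lemma dir_stat_ge0 u v : 0 <= dir_stat u v.
Proof. by rewrite mulr_ge0 ?(ltW ka0)// mulr_ge0// isqrt_ge0. Qed.

Lemma dir_stat_sqr_le u v :
  dir_stat u v ^+ 2 <= 2 * ln n%:R ^+ 2 + 4 * (n%:R^-1 * expR (dir_stat u v)).
Proof.
have := sqr_le_expR (ln_ge0 (_ : 1 <= n%:R :> R)) (dir_stat_ge0 u v).
by rewrite expRN lnK ?posrE// ler1n => /(_ n0).
Qed.

Lemma dir_statP u v t : 0 < t ->
  `|B u v| <= t * B u u + dir_stat u v ^+ 2 / (4 * ka ^+ 2) / t.
Proof.
move=> t0; apply: (norm_le_isqrt ka0 t0 (psd_ge0 hB u)).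
exact: psd_cauchy_schwarz.
Qed.

Lemma directional_bound_of_exp a s u S :
  expR (dir_stat u (\sum_i (a i - s))) <= n%:R * S ->
  directional_bound B a s u (noise_level S).
Proof.
move=> H t t0; rewrite /emp_noise (psdZr hB) normrM gtr0_norm ?invr_gt0//.
rewrite -(ler_pM2l np) mulVKf ?gt_eqF//.
(* The parameter is [t * n%:R] because the sum is [n] times the noise. *)
apply: le_trans (dir_statP _ _ (_ : 0 < t * n%:R)) _; first by rewrite mulr_gt0.
rewrite [leRHS]mulrDr [n%:R * (t * _)]mulrA (mulrC n%:R t) lerD2l.
have -> : n%:R * (noise_level S / t) =
    (2 * ln n%:R ^+ 2 + 4 * S) / (4 * ka ^+ 2) / (t * n%:R).
  by rewrite /noise_level; field; rewrite !gt_eqF.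
rewrite ler_wpM2r ?invr_ge0 ?mulr_ge0 ?(ltW t0) ?ler0n//.
rewrite ler_wpM2r ?invr_ge0 ?mulr_ge0 ?(ltW ka0)//.
apply: le_trans (dir_stat_sqr_le _ _) _; rewrite lerD2l ler_pM2l//.
by rewrite mulrC ler_pdivrMr// mulrC.
Qed.

Lemma splitting_bound_of_exp a a' s s' S :
  (2 ^ n)%:R^-1 * \sum_(I : {set 'I_n})
    expR (dir_stat (partial_sum a s I) (partial_sum a' s' (~: I))) <= n%:R * S ->
  splitting_bound B a a' s s' (noise_level S).
Proof.
move=> H t t0.
have N0 : 0 < (2 ^ n)%:R :> R by rewrite ltr0n expn_gt0.
set D := fun I => dir_stat (partial_sum a s I) (partial_sum a' s' (~: I)).
apply: (@le_trans _ _ ((2 ^ n)%:R^-1 * \sum_(I : {set 'I_n})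
    (t * B (partial_sum a s I) (partial_sum a s I)
     + (2 * ln n%:R ^+ 2 + 4 * (n%:R^-1 * expR (D I))) / (4 * ka ^+ 2) / t))).
  rewrite ler_pM2l ?invr_gt0//; apply: ler_sum => I _.
  apply: le_trans (dir_statP _ _ t0) _; rewrite lerD2l.
  rewrite ler_wpM2r ?invr_ge0 ?(ltW t0)//.
  by rewrite ler_wpM2r ?invr_ge0 ?mulr_ge0 ?(ltW ka0)// dir_stat_sqr_le.
rewrite big_split/= -mulr_sumr mulrDr mulrCA lerD2l -!mulr_suml.
have -> : n%:R ^+ 2 * (noise_level S / t) =
    (2 * ln n%:R ^+ 2 + 4 * S) / (4 * ka ^+ 2) / t.
  by rewrite /noise_level; field; rewrite !gt_eqF.
rewrite mulrA ler_wpM2r ?invr_ge0 ?(ltW t0)// mulrA.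
rewrite ler_wpM2r ?invr_ge0 ?mulr_ge0 ?(ltW ka0)//.
rewrite big_split/= sumr_const mulrDr -[(2 * ln n%:R ^+ 2) *+ _]mulr_natl.
have -> : #|{set 'I_n}| = (2 ^ n)%N.
  by rewrite -cardsT -powersetT card_powerset cardsT card_ord.
rewrite mulKf ?gt_eqF// lerD2l -mulr_sumr mulrCA ler_pM2l// -mulr_sumr mulrCA.
by rewrite ler_pdivrMl.
Qed.

End exponential_control.

(** * Moment generating functions of the centred kernel terms *)

Section moment_generating.
Context (R : realType) (d : nat).
Local Notation E := 'rV[R]_d.
Local Notation leb := (lebesgue_rV R d).
Local Notation L2 := (LfunType leb (lee1n (R := R) 2)).
Local Notation T := (E * R)%type.
Context (mu : probability T R) (ell : R -> R).
Hypothesis ell_meas : measurable_fun [set: R] ell.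
Context (alpha M : R).
Hypothesis alpha0 : 0 < alpha.
Hypothesis ell_exp : (\int[mu]_z (expR (alpha * `|ell z.2|))%:E <= M%:E)%E.

Let measurable_ell2 : measurable_fun setT (fun z : T => ell z.2).
Proof. exact: (measurableT_comp ell_meas measurable_snd). Qed.

Lemma measurable_expR_ell (a : R) :
  measurable_fun setT (fun z : T => expR (a * `|ell z.2|)).
Proof.
apply: measurableT_comp => //; apply: measurable_funM => //.
exact: measurableT_comp.
Qed.

Lemma expR_ell_integrable :
  mu.-integrable setT (fun z => (expR (alpha * `|ell z.2|))%:E).
Proof.
apply/integrableP; split.
  by apply/measurable_EFinP; exact: measurable_expR_ell.
apply: le_lt_trans (ltry M); apply: le_trans ell_exp.
rewrite le_eqVlt; apply/orP; left; apply/eqP; apply: eq_integral => z _ /=.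
by rewrite ger0_norm// expR_ge0.
Qed.

Lemma ell_integrable : mu.-integrable setT (fun z => (ell z.2)%:E).
Proof.
apply: (le_integrable measurableT _ _
  (integrableZl measurableT alpha^-1 expR_ell_integrable)).
  exact/measurable_EFinP.
move=> z _ /=; rewrite lee_fin [leRHS]ger0_norm; last first.
  by rewrite mulr_ge0 ?expR_ge0// invr_ge0 ltW.
rewrite ler_pdivlMl//; exact: le_expR.
Qed.

Let hint := ell_integrable.

Definition bv (K : E -> E -> R) (z : T) : L2 := av ell K z - sv mu ell K.

Context (m L : R) (n : nat).
Hypothesis m0 : 0 < m.
Hypothesis L1 : 1 <= L.
Hypothesis n0 : (0 < n)%N.
Hypothesis L_large : expR (- (alpha * L / 2)) <= n%:R^-1.

(* If [`|ell y| <= L] and [ip u u <= 1], then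
   [`|ip u (bv K (x, y))| <= 2 * L * sqrt (m * n)]: this scale keeps the
   exponents below 1, where [expR_le_quadratic] applies. *)
Definition kappa : R := (2 * L * Num.sqrt (m * n%:R))^-1.

Let mn0 : 0 < m * n%:R. Proof. by rewrite mulr_gt0// ltr0n. Qed.

Lemma kappa_gt0 : 0 < kappa.
Proof.
by rewrite invr_gt0 mulr_gt0 ?sqrtr_gt0// mulr_gt0// (lt_le_trans ltr01).
Qed.

Lemma kappa_sqr : kappa ^+ 2 = (4 * L ^+ 2 * (m * n%:R))^-1.
Proof.
rewrite /kappa exprVn; congr (_^-1).
by rewrite !exprMn sqr_sqrtr ?ltW//; ring.
Qed.

Local Notation ps := (ip_psd R d).

Section step.
Context (K : E -> E -> R) (u : L2).
Hypothesis hK : regular_kernel mu ell (m * n%:R) m K.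
Hypothesis u1 : ip u u <= 1.

Lemma ip_norm_le (v : L2) (a : R) : 0 <= a -> ip v v <= a ^+ 2 -> `|ip u v| <= a.
Proof.
move=> a0 va; rewrite -(ler_pXn2r (ltn0Sn 1)) ?nnegrE// real_normK ?num_real//.
apply: le_trans (psd_cauchy_schwarz ps u v) _; apply: le_trans va.
by rewrite ler_piMl// (psd_ge0 ps).
Qed.

(** The linear term [x] stays on the right even where the indicator vanishes, so that it integrates
    to exactly 0. For |ell| > L the left side is 0, and the exponential summand is there to dominate
    -x. *)
Lemma bv_exp_le z x : x = kappa * ip u (bv K z) ->
  (`|ell z.2| <= L)%R%:R * expR x <=
  x + (1 + 4 * kappa ^+ 2 * (L ^+ 2 * ip u (kv K z.1) ^+ 2 + m)
       + 2 / alpha / n%:R * expR (alpha * `|ell z.2|)).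
Proof.
move=> xdef; have k0 := kappa_gt0.
set q := Num.sqrt (m * n%:R).
have q0 : 0 <= q by exact: sqrtr_ge0.
have kLq : kappa * (2 * L * q) = 1.
  by rewrite /kappa mulVf// mulf_neq0 ?gt_eqF ?sqrtr_gt0// mulr_gt0// (lt_le_trans ltr01).
have ipK : `|ip u (kv K z.1)| <= q.
  by apply: ip_norm_le; rewrite // sqr_sqrtr ?(ltW mn0)//; exact: ip_kv_le hK _.
have ips : ip u (sv mu ell K) ^+ 2 <= m.
  apply: le_trans (psd_cauchy_schwarz ps _ _) _.
  apply: le_trans (ip_sv_le ell_meas hK); rewrite ler_piMl// (psd_ge0 ps)//.
have ipS : `|ip u (sv mu ell K)| <= q.
  rewrite -(ler_pXn2r (ltn0Sn 1)) ?nnegrE// real_normK ?num_real// sqr_sqrtr ?(ltW mn0)//.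
  by apply: le_trans ips _; rewrite ler_peMr ?(ltW m0)// ler1n.
have xE : x = kappa * (ell z.2 * ip u (kv K z.1)) - kappa * ip u (sv mu ell K).
  by rewrite xdef /bv /av (psdBr ps) (psdZr ps) mulrBr.
have e0 : 0 <= 2 / alpha / n%:R * expR (alpha * `|ell z.2|).
  by rewrite mulr_ge0 ?expR_ge0// !mulr_ge0 ?invr_ge0 ?ler0n// ltW.
have s0 : 0 <= 4 * kappa ^+ 2 * (L ^+ 2 * ip u (kv K z.1) ^+ 2 + m).
  apply: mulr_ge0; first by rewrite mulr_ge0 ?sqr_ge0.
  by rewrite addr_ge0 ?(ltW m0)// mulr_ge0 ?sqr_ge0.
have [lL|Ll] := leP `|ell z.2| L; rewrite ?mul1r ?mul0r.
  have x1 : x <= 1.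
    rewrite xE; apply: le_trans (ler_norm _) _; apply: le_trans (ler_normB _ _) _.
    rewrite !normrM (gtr0_norm k0) -mulrDr -kLq ler_pM2l//.
    have : `|ell z.2| * `|ip u (kv K z.1)| <= L * q by exact: ler_pM.
    have : q <= L * q by rewrite ler_peMl.
    lra.
  apply: le_trans (expR_le_quadratic x1) _.
  have : x ^+ 2 <= 2 * (kappa ^+ 2 * (L ^+ 2 * ip u (kv K z.1) ^+ 2 + m)).
    rewrite xE -mulrBr exprMn -(mulrCA (kappa ^+ 2)) ler_pM2l ?exprn_gt0//.
    have : (ell z.2 * ip u (kv K z.1)) ^+ 2 <= L ^+ 2 * ip u (kv K z.1) ^+ 2.
      rewrite exprMn ler_wpM2r ?sqr_ge0// -real_normK ?num_real//.
      by rewrite lerXn2r ?nnegrE// (le_trans _ lL).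
    move: ips; move: (ell z.2 * _) (ip u (sv mu ell K)) => a b.
    by have := sqr_ge0 (a + b); rewrite !expr2; lra.
  lra.
have l1 : 1 <= `|ell z.2| by rewrite (le_trans L1)// ltW.
have : `|x| <= `|ell z.2|.
  rewrite xE; apply: le_trans (ler_normB _ _) _.
  rewrite !normrM (gtr0_norm k0) -mulrDr.
  have : `|ell z.2| * `|ip u (kv K z.1)| + `|ip u (sv mu ell K)| <= 2 * L * q * `|ell z.2|.
    have : `|ell z.2| * `|ip u (kv K z.1)| <= `|ell z.2| * q by exact: ler_wpM2l.
    have : q <= `|ell z.2| * q by rewrite ler_peMl.
    have : `|ell z.2| * q <= L * (`|ell z.2| * q) by rewrite ler_peMl ?mulr_ge0.
    rewrite -!mulrA (mulrC q); lra.
  by rewrite -(ler_pM2l k0) [in leRHS]mulrA kLq mul1r.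
(* With v = alpha |ell| / 2, use v <= exp(v) = exp(-v) exp(2 v) and exp(-v) <= exp(-alpha L / 2) <=
   1/n. *)
have : `|ell z.2| <= 2 / alpha / n%:R * expR (alpha * `|ell z.2|).
  have : alpha * `|ell z.2| / 2 <= expR (alpha * `|ell z.2| / 2) by exact: le_expR.
  have : expR (alpha * `|ell z.2| / 2) <= n%:R^-1 * expR (alpha * `|ell z.2|).
    apply: (@le_trans _ _ (expR (- (alpha * L / 2)) * expR (alpha * `|ell z.2|))).
      rewrite -expRD ler_expR.
      have : alpha * L <= alpha * `|ell z.2| by rewrite ler_pM2l// ltW.
      lra.
    by rewrite ler_wpM2r ?expR_ge0.
  move=> H1 H2; have {}H1 := le_trans H2 H1.
  rewrite -[leRHS]mulrA; apply: le_trans (ler_wpM2l _ H1); last first.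
    by rewrite divr_ge0// ltW.
  rewrite le_eqVlt; apply/orP; left; apply/eqP; field; exact: lt0r_neq0.
have := ler_norm (- x); rewrite normrN; lra.
Qed.

(* The linear term has mean zero, and by condition (4) the quadratic one has mean
   at most of order [1 / n]. *)
Lemma mgf_step :
  (\int[mu]_z ((`|ell z.2| <= L)%R%:R * expR (kappa * ip u (bv K z)))%:E <=
   (1 + (2 + 2 / alpha * M) / n%:R)%:E)%E.
Proof.
pose x z := kappa * ip u (bv K z).
pose y z := 1 + 4 * kappa ^+ 2 * (L ^+ 2 * ip u (kv K z.1) ^+ 2 + m)
       + 2 / alpha / n%:R * expR (alpha * `|ell z.2|).
have [iav avE] := ip_mean ell_meas hint hK u.
have mkv : measurable_fun setT (fun z : T => ip u (kv K z.1)).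
  exact: (measurableT_comp (measurable_ip_kv hK u) measurable_fst).
have mKexp := measurable_expR_ell alpha.
have xE z : x z = kappa * ip u (av ell K z) - kappa * ip u (sv mu ell K).
  by rewrite /x /bv (psdBr ps) mulrBr.
have iav' := integrableZl measurableT kappa iav.
have icst : mu.-integrable setT (cst (kappa * ip u (sv mu ell K))%:E).
  exact: finite_measure_integrable_cst.
have ix : mu.-integrable setT (fun z => (x z)%:E).
  rewrite (_ : (fun z => _) = (fun z => kappa%:E * (ip u (av ell K z))%:E)
      \- cst (kappa * ip u (sv mu ell K))%:E)%E; first exact: integrableB.
  by apply/funext => z; rewrite xE.
have x0 : (\int[mu]_z (x z)%:E = 0)%E.
  transitivity (\int[mu]_z (kappa%:E * (ip u (av ell K z))%:E
      - cst (kappa * ip u (sv mu ell K))%:E z))%E.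
    by apply: eq_integral => z _; rewrite xE.
  rewrite integralB// integralZl// avE.
  by rewrite integral_prob_cst -EFinM subee.
have mip2 : measurable_fun setT (fun z : T => (ip u (kv K z.1) ^+ 2)%:E).
  exact/measurable_EFinP/measurable_funX.
have k0 := kappa_gt0.
have a0 : 0 <= 1 + 4 * kappa ^+ 2 * m.
  by rewrite addr_ge0// mulr_ge0 ?(ltW m0)// mulr_ge0 ?sqr_ge0.
have b0 : 0 <= 4 * kappa ^+ 2 * L ^+ 2 by rewrite mulr_ge0 ?sqr_ge0// mulr_ge0 ?sqr_ge0.
have c0 : 0 <= 2 / alpha / n%:R by rewrite !divr_ge0 ?ler0n// ltW.
have yE z : (y z)%:E = ((1 + 4 * kappa ^+ 2 * m)%:E
    + (4 * kappa ^+ 2 * L ^+ 2)%:E * (ip u (kv K z.1) ^+ 2)%:E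
    + (2 / alpha / n%:R)%:E * (expR (alpha * `|ell z.2|))%:E)%E.
  by rewrite -!EFinM -!EFinD /y; congr EFin; ring.
have y0 z : 0 <= y z.
  by rewrite -lee_fin yE !adde_ge0 ?mule_ge0 ?lee_fin ?expR_ge0 ?sqr_ge0.
have my : measurable_fun setT (fun z => (y z)%:E).
  under eq_fun do rewrite yE.
  apply: emeasurable_funD; last by apply: emeasurable_funM => //; exact/measurable_EFinP.
  by apply: emeasurable_funD => //; apply: emeasurable_funM.
have yi : (\int[mu]_z (y z)%:E <= (1 + (2 + 2 / alpha * M) / n%:R)%:E)%E.
  under eq_integral do rewrite yE.
  rewrite ge0_integralD//; first last.
  - by apply: emeasurable_funM => //; exact/measurable_EFinP.
  - by move=> z _; rewrite mule_ge0 ?lee_fin ?expR_ge0.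
  - by apply: emeasurable_funD => //; apply: emeasurable_funM.
  - by move=> z _; rewrite adde_ge0 ?mule_ge0 ?lee_fin ?sqr_ge0.
  rewrite ge0_integralD//; first last.
  - exact: emeasurable_funM.
  - by move=> z _; rewrite mule_ge0 ?lee_fin ?sqr_ge0.
  rewrite ge0_integralZl//; last by move=> z _; rewrite lee_fin sqr_ge0.
  rewrite ge0_integralZl//; last exact/measurable_EFinP.
  rewrite integral_prob_cst.
  (* By [kappa_sqr] the terms in [kappa ^+ 2] are at most 1/n each, which is the 2 in the numerator
     of the bound. *)
  apply: (@le_trans _ _ ((1 + 4 * kappa ^+ 2 * m)%:E
     + (4 * kappa ^+ 2 * L ^+ 2)%:E * m%:E + (2 / alpha / n%:R)%:E * M%:E)%E).
    apply: leeD; last by rewrite lee_wpmul2l// lee_fin.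
    apply: leeD => //; rewrite lee_wpmul2l ?lee_fin//.
    apply: le_trans (rk_weak hK u) _; rewrite lee_fin ler_piMr// ltW//.
  rewrite -!EFinM -!EFinD lee_fin kappa_sqr -!addrA lerD2l.
  have nn0 : n%:R != 0 :> R by rewrite pnatr_eq0 -lt0n.
  have L0 : L != 0 by rewrite gt_eqF// (lt_le_trans ltr01).
  have mn0' : m != 0 by rewrite gt_eqF.
  have -> : 4 * (4 * L ^+ 2 * (m * n%:R))^-1 * m = n%:R^-1 * (L ^+ 2)^-1.
    by field; rewrite nn0 L0 mn0'.
  have -> : 4 * (4 * L ^+ 2 * (m * n%:R))^-1 * L ^+ 2 * m = n%:R^-1.
    by field; rewrite nn0 L0 mn0'.
  have -> : 2 / alpha / n%:R * M = 2 / alpha * M / n%:R by rewrite mulrAC.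
  have -> : (1 + (1 + 2 / alpha * M)) / n%:R = n%:R^-1 + (n%:R^-1 + 2 / alpha * M / n%:R).
    by rewrite mulrDl; ring.
  by rewrite lerD2r ler_piMr ?invr_ge0 ?ler0n// invf_le1 ?exprn_ege1// exprn_gt0// (lt_le_trans ltr01).
have iy : mu.-integrable setT (fun z => (y z)%:E).
  apply/integrableP; split=> //; apply: le_lt_trans (ltry (1 + (2 + 2 / alpha * M) / n%:R)).
  apply: le_trans yi; rewrite le_eqVlt; apply/orP; left; apply/eqP.
  by apply: eq_integral => z _ /=; rewrite ger0_norm.
apply: (@le_trans _ _ (\int[mu]_z ((x z)%:E + (y z)%:E))%E).
  apply: ge0_le_integral => //.
  - apply/measurable_EFinP; apply: measurable_funM.
      apply: (measurableT_comp (f := fun b : bool => b%:R : R)) => //.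
      apply: measurable_fun_ler => //; exact: measurableT_comp.
    apply: measurableT_comp => //; apply/measurable_EFinP; exact: measurable_int ix.
  - by apply: emeasurable_funD => //; exact: measurable_int ix.
  - by move=> z _; rewrite -EFinD lee_fin; exact: bv_exp_le.
by rewrite integralD// x0 add0e.
Qed.

End step.

Definition small (t : T) : bool := `|ell t.2| <= L.

Definition good (z : n.-tuple T) : R := \prod_(i < n) (small (tnth z i))%:R.

Lemma good_forall z : good z = [forall i, small (tnth z i)]%:R.
Proof.
rewrite /good; case: forallP => [h|/existsNP[i /negP/negbTE hi]].
  by rewrite big1// => i _; rewrite h.
by rewrite (bigD1 i)//= hi mul0r.
Qed.

Lemma measurable_small : measurable_fun setT (fun t : T => (small t)%:R : R).
Proof.
apply: (measurableT_comp (f := fun b : bool => b%:R : R)) => //.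
by apply: measurable_fun_ler => //; exact: measurableT_comp.
Qed.

Lemma measurable_good : measurable_fun setT good.
Proof.
apply: measurable_prod => i _.
exact: (measurableT_comp measurable_small (measurable_tnth i)).
Qed.

Definition mgf_cst : R := 2 + 2 / alpha * M.

Lemma M_ge0 : 0 <= M.
Proof.
rewrite -lee_fin; apply: le_trans ell_exp; apply: integral_ge0 => z _.
by rewrite lee_fin expR_ge0.
Qed.

Lemma mgf_cst_ge0 : 0 <= mgf_cst.
Proof. by rewrite addr_ge0// mulr_ge0 ?M_ge0// divr_ge0// ltW. Qed.

Context disp (Omega : measurableType disp) (P : probability Omega R)
  (Z : 'I_n -> {RV P >-> T}).
Hypothesis Z_iid : iid_with_law mu Z.

Section block.
Context (K : E -> E -> R) (s : seq 'I_n).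
Hypothesis hK : regular_kernel mu ell (m * n%:R) m K.
Hypothesis us : uniq s.

Lemma measurable_block (u : n.-tuple T -> L2) :
  measurable_fun setT (fun p : n.-tuple T * T => ip (u p.1) (bv K p.2)) ->
  measurable_fun setT (fun w =>
    ip (u (sample Z w)) (\sum_(j <- s) bv K (Z j w))).
Proof.
move=> mu_; under eq_fun do rewrite (psd_sumr ps).
apply: measurable_sum => j.
have m2 : measurable_fun setT (fun w => (sample Z w, Z j w)).
  by apply: measurable_fun_pair; [exact: measurable_sample|exact: measurable_funPT].
exact: (measurableT_comp mu_ m2).
Qed.

Lemma measurable_good_sample : measurable_fun setT (fun w => good (sample Z w)).
Proof. exact: (measurableT_comp measurable_good (measurable_sample Z)). Qed.

(** The direction ignores the coordinates in [s], so [expectation_prod_le] applies with factors of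
    mean at most 1 + mgf_cst / n. [good] is at most the product of the indicators over [s], and
    there are at most [n] factors, whence (1 + mgf_cst / n)^n <= exp(mgf_cst). *)
Lemma mgf_block_signed (u : n.-tuple T -> L2) :
  (forall z, ip (u z) (u z) <= 1) ->
  measurable_fun setT (fun p : n.-tuple T * T => ip (u p.1) (bv K p.2)) ->
  (forall j z t, j \in s -> u (replace j z t) = u z) ->
  (\int[P]_w (good (sample Z w) * expR (kappa *
      ip (u (sample Z w)) (\sum_(j <- s) bv K (Z j w))))%:E <=
   (expR mgf_cst)%:E)%E.
Proof.
move=> u1 mu_ uloc.
pose g (p : n.-tuple T * T) : R := (small p.2)%:R * expR (kappa * ip (u p.1) (bv K p.2)).
have mg : measurable_fun setT g.
  apply: measurable_funM; first exact: (measurableT_comp measurable_small measurable_snd).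
  by apply: measurableT_comp => //; exact: measurable_funM.
have C0 : 0 <= mgf_cst / n%:R by rewrite divr_ge0 ?mgf_cst_ge0 ?ler0n.
have g0 p : 0 <= g p by rewrite mulr_ge0 ?expR_ge0 ?ler0n.
have expE z : expR (kappa * ip (u z) (\sum_(j <- s) bv K (tnth z j))) =
    \prod_(j <- s) expR (kappa * ip (u z) (bv K (tnth z j))).
  by rewrite (psd_sumr ps) mulr_sumr expR_sum.
have sE w : \sum_(j <- s) bv K (Z j w) = \sum_(j <- s) bv K (tnth (sample Z w) j).
  by apply: eq_bigr => j _; rewrite tnth_mktuple.
apply: (@le_trans _ _ (\int[P]_w (\prod_(j <- s) g (sample Z w, Z j w))%:E)%E).
  have mZ j := measurable_funPT (Z j).
  have mS := measurable_sample Z.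
  have mgj j : measurable_fun setT (fun w => g (sample Z w, Z j w)).
    by apply: (measurableT_comp mg); exact: measurable_fun_pair.
  apply: ge0_le_integral => //.
  - move=> w _; rewrite lee_fin mulr_ge0 ?expR_ge0// good_forall ler0n//.
  - apply/measurable_EFinP; apply: measurable_funM; first exact: measurable_good_sample.
    apply: measurableT_comp => //; apply: measurable_funM => //.
    exact: measurable_block.
  - apply/measurable_EFinP; apply: measurable_prod => j _; exact: mgj.
  - move=> w _; rewrite lee_fin good_forall.
    case: forallP => [h|_]; last by rewrite mul0r prodr_ge0.
    rewrite mul1r sE expE le_eqVlt; apply/orP; left; apply/eqP.
    by apply: eq_bigr => j _; have := h j; rewrite tnth_mktuple /g/= => ->; rewrite mul1r.
apply: le_trans (expectation_prod_le Z_iid (C := 1 + mgf_cst / n%:R) us _ mg g0 _ _) _.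
- by rewrite addr_ge0.
- by move=> j z t t' js; rewrite /g/= uloc.
- by move=> z; rewrite /g/=; exact: mgf_step.
rewrite lee_fin; apply: (@le_trans _ _ ((1 + mgf_cst / n%:R) ^+ n)).
  rewrite ler_weXn2l ?lerDl// -(card_uniqP us).
  by rewrite (leq_trans (max_card _))// card_ord.
apply: (@le_trans _ _ (expR (mgf_cst / n%:R) ^+ n)).
  by rewrite lerXn2r ?nnegrE ?expR_ge0 ?addr_ge0//; exact: expR_ge1Dx.
by rewrite -expRM_natr divfK// pnatr_eq0 -lt0n.
Qed.

Lemma mgf_block (u : n.-tuple T -> L2) :
  (forall z, ip (u z) (u z) <= 1) ->
  measurable_fun setT (fun p : n.-tuple T * T => ip (u p.1) (bv K p.2)) ->
  (forall j z t, j \in s -> u (replace j z t) = u z) ->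
  (\int[P]_w (good (sample Z w) * expR (kappa *
      `|ip (u (sample Z w)) (\sum_(j <- s) bv K (Z j w))|))%:E <=
   (2 * expR mgf_cst)%:E)%E.
Proof.
move=> u1 mu_ uloc.
pose f (v : n.-tuple T -> L2) w := (good (sample Z w) * expR (kappa *
  ip (v (sample Z w)) (\sum_(j <- s) bv K (Z j w))))%:E.
have uN1 z : ip (- u z) (- u z) <= 1 by rewrite (psdNl ps) (psdNr ps) opprK.
have muN : measurable_fun setT (fun p : n.-tuple T * T => ip (- u p.1) (bv K p.2)).
  by under eq_fun do rewrite (psdNl ps); exact: measurableT_comp.
have uNloc j z t : j \in s -> - u (replace j z t) = - u z by move=> js; rewrite uloc.
have good0 w : 0 <= good (sample Z w) by rewrite good_forall ler0n.
have f0 v w : (0 <= f v w)%E by rewrite lee_fin mulr_ge0 ?expR_ge0.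
have mf v : measurable_fun setT (fun p : n.-tuple T * T => ip (v p.1) (bv K p.2)) ->
    measurable_fun setT (f v).
  move=> mv; apply/measurable_EFinP; apply: measurable_funM; first exact: measurable_good_sample.
  by apply: measurableT_comp => //; apply: measurable_funM => //; exact: measurable_block.
pose uN z := - u z.
apply: (@le_trans _ _ (\int[P]_w (f u w + f uN w))%E).
  apply: ge0_le_integral => //.
  - by move=> w _; rewrite lee_fin mulr_ge0 ?expR_ge0.
  - apply/measurable_EFinP; apply: measurable_funM; first exact: measurable_good_sample.
    apply: measurableT_comp => //; apply: measurable_funM => //.
    by apply: measurableT_comp => //; exact: measurable_block.
  - by apply: emeasurable_funD; exact: mf.
  - move=> w _; rewrite lee_fin -mulrDr ler_wpM2l// (psdNl ps) mulrN.
    apply: le_trans (expR_norm_le _); rewrite normrM (gtr0_norm kappa_gt0)//.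
rewrite ge0_integralD//; first last.
- exact: mf.
- exact: mf.
by rewrite mulr_natl mulr2n EFinD; apply: leeD; apply: mgf_block_signed.
Qed.

End block.

Lemma measurable_ip_kv2 K K' :
  regular_kernel mu ell (m * n%:R) m K -> regular_kernel mu ell (m * n%:R) m K' ->
  measurable_fun setT (fun p : E * E => ip (kv K p.1) (kv K' p.2)).
Proof.
move=> hK hK'.
rewrite (_ : (fun p => _) = fun p => \int[leb]_t (K p.1 t * K' p.2 t)); last first.
  by apply/funext => p; rewrite /ip (kvE hK) (kvE hK').
apply: (measurable_fun_Rintegral leb
  (f := fun p : (E * E) * E => K p.1.1 p.2 * K' p.1.2 p.2)).
have m1 : measurable_fun setT (fun p : (E * E) * E => (p.1.1, p.2)).
  by apply: measurable_fun_pair => //; exact: (measurableT_comp measurable_fst measurable_fst).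
have m2 : measurable_fun setT (fun p : (E * E) * E => (p.1.2, p.2)).
  by apply: measurable_fun_pair => //; exact: (measurableT_comp measurable_snd measurable_fst).
by apply: measurable_funM; [exact: (measurableT_comp (rk_meas hK) m1)|
  exact: (measurableT_comp (rk_meas hK') m2)].
Qed.

Lemma measurable_ip_av K (u : L2) : regular_kernel mu ell (m * n%:R) m K ->
  measurable_fun setT (fun z : T => ip u (av ell K z)).
Proof.
move=> hK; under eq_fun do rewrite /av (psdZr ps).
apply: measurable_funM => //.
exact: (measurableT_comp (measurable_ip_kv hK u) measurable_fst).
Qed.

Lemma measurable_ip_bv2 K K' :
  regular_kernel mu ell (m * n%:R) m K -> regular_kernel mu ell (m * n%:R) m K' ->
  measurable_fun setT (fun p : T * T => ip (bv K p.1) (bv K' p.2)).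
Proof.
move=> hK hK'.
rewrite (_ : (fun p => _) = fun p : T * T =>
    ell p.1.2 * (ell p.2.2 * ip (kv K p.1.1) (kv K' p.2.1))
    - ip (sv mu ell K') (av ell K p.1)
    - (ip (sv mu ell K) (av ell K' p.2) - ip (sv mu ell K) (sv mu ell K'))).
  apply: measurable_funB; last first.
    apply: measurable_funB => //.
    exact: (measurableT_comp (measurable_ip_av _ hK') measurable_snd).
  apply: measurable_funB; last first.
    exact: (measurableT_comp (measurable_ip_av _ hK) measurable_fst).
  apply: measurable_funM; first exact: (measurableT_comp measurable_ell2 measurable_fst).
  apply: measurable_funM; first exact: (measurableT_comp measurable_ell2 measurable_snd).
  have m2 : measurable_fun setT (fun p : T * T => (p.1.1, p.2.1)).
    apply: measurable_fun_pair.
      exact: (measurableT_comp measurable_fst measurable_fst).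
    exact: (measurableT_comp measurable_fst measurable_snd).
  exact: (measurableT_comp (measurable_ip_kv2 hK hK') m2).
apply/funext => p; rewrite /bv !(psdBl ps, psdBr ps) (psdC ps (sv mu ell K') _).
by rewrite {1}/av (psdZl ps) {1}/av (psdZr ps); ring.
Qed.

Lemma ip_isqrt_le1 (v : L2) : ip (isqrt (ip v v) *: v) (isqrt (ip v v) *: v) <= 1.
Proof.
by rewrite (psdZl ps) (psdZr ps) mulrA -expr2 isqrt_sqr_le1// (psd_ge0 ps).
Qed.

Lemma dir_statE (u v : L2) :
  dir_stat (@ip R d) kappa u v = kappa * `|ip (isqrt (ip u u) *: u) v|.
Proof. by rewrite /dir_stat (psdZl ps) normrM [`|isqrt _|]ger0_norm// isqrt_ge0. Qed.

Lemma mgf_direction (eta : L2) K : regular_kernel mu ell (m * n%:R) m K ->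
  (\int[P]_w (good (sample Z w) *
      expR (dir_stat (@ip R d) kappa eta (\sum_i bv K (Z i w))))%:E <=
   (2 * expR mgf_cst)%:E)%E.
Proof.
move=> hK; under eq_integral do rewrite dir_statE.
apply: (mgf_block hK (index_enum_uniq _) (u := fun=> isqrt (ip eta eta) *: eta)) => //.
  by move=> z; exact: ip_isqrt_le1.
have h := measurable_ip_av (isqrt (ip eta eta) *: eta) hK.
under eq_fun do rewrite /bv (psdBr ps).
apply: measurable_funB => //.
exact: (measurableT_comp h measurable_snd).
Qed.

Lemma measurable_mgf_direction (eta : L2) K : regular_kernel mu ell (m * n%:R) m K ->
  measurable_fun setT (fun w => good (sample Z w) *
      expR (dir_stat (@ip R d) kappa eta (\sum_i bv K (Z i w)))).
Proof.
move=> hK; apply: measurable_funM; first exact: measurable_good_sample.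
apply: measurableT_comp => //; apply: measurable_funM => //; apply: measurable_funM => //.
apply: measurableT_comp => //.
under eq_fun do rewrite (psd_sumr ps).
apply: measurable_sum => i.
under eq_fun do rewrite /bv (psdBr ps).
apply: measurable_funB => //.
exact: (measurableT_comp (measurable_ip_av eta hK) (measurable_funPT (Z i))).
Qed.

(* The block [I] gives the direction, which is frozen when the block [~: I] is
   integrated out. *)
Section splitting.
Context (K K' : E -> E -> R) (I : {set 'I_n}).
Hypothesis hK : regular_kernel mu ell (m * n%:R) m K.
Hypothesis hK' : regular_kernel mu ell (m * n%:R) m K'.

Let G (z : n.-tuple T) : L2 := \sum_(i in I) bv K (tnth z i).

Let u z : L2 := isqrt (ip (G z) (G z)) *: G z.

Let measurable_u : measurable_fun setT (fun p : n.-tuple T * T => ip (u p.1) (bv K' p.2)).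
Proof.
under eq_fun do rewrite /u (psdZl ps).
have mt i : measurable_fun setT (fun p : n.-tuple T * T => tnth p.1 i).
  exact: (measurableT_comp (measurable_tnth i) measurable_fst).
apply: measurable_funM.
  apply: (measurableT_comp (@measurable_isqrt R)).
  rewrite /G; under eq_fun do rewrite (psd_suml ps).
  under eq_fun do rewrite big_mkcond/=.
  apply: measurable_sum => i; case: (i \in I) => //.
  under eq_fun do rewrite (psd_sumr ps) big_mkcond/=.
  apply: measurable_sum => j; case: (j \in I) => //.
  exact: (measurableT_comp (measurable_ip_bv2 hK hK) (measurable_fun_pair (mt i) (mt j))).
rewrite /G; under eq_fun do rewrite (psd_suml ps) big_mkcond/=.
apply: measurable_sum => i; case: (i \in I) => //.
exact: (measurableT_comp (measurable_ip_bv2 hK hK') (measurable_fun_pair (mt i) measurable_snd)).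
Qed.

Let sumE K0 (J : {set 'I_n}) w :
  \sum_(i in J) bv K0 (Z i w) = \sum_(j <- enum J) bv K0 (Z j w).
Proof. by rewrite big_enum. Qed.

Let GE w : \sum_(i in I) bv K (Z i w) = G (sample Z w).
Proof. by apply: eq_bigr => i _; rewrite tnth_mktuple. Qed.

Lemma mgf_splitting :
  (\int[P]_w (good (sample Z w) * expR (dir_stat (@ip R d) kappa
      (\sum_(i in I) bv K (Z i w)) (\sum_(i in ~: I) bv K' (Z i w))))%:E <=
   (2 * expR mgf_cst)%:E)%E.
Proof.
under eq_integral do rewrite dir_statE GE sumE.
apply: (mgf_block hK' (enum_uniq _) (u := u)) => //.
  by move=> z; exact: ip_isqrt_le1.
move=> j z t; rewrite mem_enum inE => jI.
suff Gloc : G (replace j z t) = G z by rewrite /u Gloc.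
apply: eq_bigr => i iI; rewrite tnth_mktuple; case: eqP => // ij.
by rewrite -ij iI in jI.
Qed.

Lemma measurable_mgf_splitting :
  measurable_fun setT (fun w => good (sample Z w) * expR (dir_stat (@ip R d) kappa
      (\sum_(i in I) bv K (Z i w)) (\sum_(i in ~: I) bv K' (Z i w)))).
Proof.
under eq_fun do rewrite dir_statE GE sumE.
apply: measurable_funM; first exact: measurable_good_sample.
apply: measurableT_comp => //; apply: measurable_funM => //.
apply: measurableT_comp => //; exact: (measurable_block _ measurable_u).
Qed.

End splitting.

(** * The oracle inequality for a fixed sample size *)

Section oracle.
(** The cube pays for a factor n from Cauchy-Schwarz and one from the number of summands in
    [risk_bad], leaving 1/n. *)
Hypothesis L_larger : expR (- (alpha * L / 2)) <= n%:R ^- 3.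
Context (h : 'I_n -> E -> E -> R) (k0 : 'I_n) (s : L2).
Hypothesis hreg : forall k, regular_kernel mu ell (m * n%:R) m (h k).

Local Notation a k w := (fun i => av ell (h k) (Z i w)).
Local Notation sk k := (sv mu ell (h k)).
Local Notation eta k := (sk k - s).

Definition risk k w : R := ip (emp_mean (a k w) - s) (emp_mean (a k w) - s).

Definition crit k w : R :=
  ip (emp_mean (a k w) - emp_mean (a k0 w)) (emp_mean (a k w) - emp_mean (a k0 w))
  + 2 * (n%:R ^- 2 * \sum_i ip (av ell (h k) (Z i w)) (av ell (h k0) (Z i w))).

Definition exp_dir k k' w : R :=
  expR (dir_stat (@ip R d) kappa (eta k) (\sum_i bv (h k') (Z i w))).

Definition exp_split k k' (I : {set 'I_n}) w : R :=
  expR (dir_stat (@ip R d) kappa (\sum_(i in I) bv (h k) (Z i w))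
    (\sum_(i in ~: I) bv (h k') (Z i w))).

(** One summand for each of the four fluctuation hypotheses of [ideal_pen_bound]. *)
Definition exp_stat k w : R := exp_dir k k0 w + exp_dir k k w +
  (2 ^ n)%:R^-1 * (\sum_(I : {set 'I_n}) exp_split k k0 I w
    + \sum_(I : {set 'I_n}) exp_split k k I w).

(** The union bound over the kernels, written as a mean: each term is at most [n] times it, the
    factor that [noise_level] allows for. *)
Definition exp_total w : R := n%:R^-1 * \sum_k exp_stat k w.

Let nR0 : 0 < n%:R :> R. Proof. by rewrite ltr0n. Qed.

Let exp_stat_ge0 k w : 0 <= exp_stat k w.
Proof.
rewrite !addr_ge0 ?expR_ge0// mulr_ge0 ?invr_ge0 ?ler0n// addr_ge0//;
  by apply: sumr_ge0 => I _; exact: expR_ge0.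
Qed.

Lemma exp_stat_le_total k w : exp_stat k w <= n%:R * exp_total w.
Proof.
rewrite /exp_total mulVKf ?gt_eqF// (bigD1 k)//= lerDl.
by apply: sumr_ge0 => i _.
Qed.

Lemma exp_total_ge0 w : 0 <= exp_total w.
Proof. by rewrite mulr_ge0 ?invr_ge0 ?ler0n// sumr_ge0. Qed.

Lemma noise_levelE (S : R) : noise_level n kappa S =
  L ^+ 2 * m / n%:R * (2 * ln n%:R ^+ 2 + 4 * S).
Proof.
have L0 : L != 0 by rewrite gt_eqF// (lt_le_trans ltr01).
by rewrite /noise_level kappa_sqr; field; rewrite !gt_eqF ?(lt_le_trans ltr01 L1).
Qed.

Lemma noise_level_ge0 w : 0 <= noise_level n kappa (exp_total w).
Proof.
rewrite noise_levelE; apply: mulr_ge0.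
  by rewrite divr_ge0 ?ler0n// mulr_ge0 ?sqr_ge0// ltW.
by rewrite addr_ge0// mulr_ge0 ?sqr_ge0 ?exp_total_ge0.
Qed.

Lemma ideal_pen_control k w t : 0 < t -> t <= 1 ->
  `|ideal_pen (@ip R d) (a k w) (a k0 w) (sk k0) s| <=
    5 * (t * risk k w) + (63 * noise_level n kappa (exp_total w)
      + ip (eta k0) (eta k0) + 2 * (m / n%:R)) / t.
Proof.
move=> t0 t1; have k_gt0 := kappa_gt0.
have SS := exp_stat_le_total k w.
have sum_ge0 k' : 0 <= (2 ^ n)%:R^-1 * \sum_(I : {set 'I_n}) exp_split k k' I w.
  by rewrite mulr_ge0 ?invr_ge0 ?ler0n// sumr_ge0// => I _; exact: expR_ge0.
have dir_ge0 k1 k2 : 0 <= exp_dir k1 k2 w by exact: expR_ge0.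
have d0 : exp_dir k k0 w <= n%:R * exp_total w.
  by apply: le_trans SS; rewrite /exp_stat mulrDr -addrA lerDl !addr_ge0.
have dk : exp_dir k k w <= n%:R * exp_total w.
  apply: le_trans SS; rewrite /exp_stat mulrDr (addrC (exp_dir k k0 w)) -addrA lerDl.
  by rewrite !addr_ge0.
have s0 : (2 ^ n)%:R^-1 * \sum_(I : {set 'I_n}) exp_split k k0 I w <= n%:R * exp_total w.
  by apply: le_trans SS; rewrite /exp_stat mulrDr addrCA lerDl !addr_ge0.
have sk' : (2 ^ n)%:R^-1 * \sum_(I : {set 'I_n}) exp_split k k I w <= n%:R * exp_total w.
  by apply: le_trans SS; rewrite /exp_stat mulrDr addrA lerDr !addr_ge0.
apply: (ideal_pen_bound ps n0 (sK := sk k)) => //.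
- exact: noise_level_ge0.
- exact: ip_sv_le.
- exact: ip_sv_le.
- exact: (directional_bound_of_exp ps n0 k_gt0 d0).
- exact: (directional_bound_of_exp ps n0 k_gt0 dk).
- exact: (splitting_bound_of_exp ps n0 k_gt0 s0).
- exact: (splitting_bound_of_exp ps n0 k_gt0 sk').
Qed.

Lemma selection_control k k' w th : 0 < th -> th < 1 -> crit k' w <= crit k w ->
  risk k' w <= (1 + th) * risk k w
    + 180 * ((63 * noise_level n kappa (exp_total w)
      + ip (eta k0) (eta k0) + 2 * (m / n%:R)) / th).
Proof.
move=> th0 th1 H.
have t0 : 0 < th / 30 by rewrite divr_gt0.
have t1 : th / 30 <= 1 by lra.
have := ideal_pen_control k w t0 t1; have := ideal_pen_control k' w t0 t1.
move=> H' Hk.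
pose c := risk k0 w + 2 * (n%:R^-1 * ip s (emp_noise (a k0 w) (sk k0))).
apply: (selection_inequality (c := c) th0 th1 _ _ Hk H').
- exact: (psd_ge0 ps).
- rewrite !addr_ge0 ?(psd_ge0 ps)//; first by rewrite mulr_ge0// noise_level_ge0.
  by rewrite mulr_ge0// divr_ge0 ?ler0n// ltW.
- have critE k1 : crit k1 w =
      risk k1 w - 2 * ideal_pen (@ip R d) (a k1 w) (a k0 w) (sk k0) s + c.
    by have := criterion_expand ps (a k1 w) (a k0 w) (sk k0) s.
  by rewrite -!critE.
Qed.

Local Notation e_sum w := (\sum_i expR (alpha * `|ell (Z i w).2|)).

(** Twice [m] times the constant 8 / alpha^2 in ell^2 <= (8 / alpha^2) exp(alpha |ell| / 2), plus
    the norm of the target. *)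
Definition bad_cst : R := 16 * m / alpha ^+ 2 + 2 * ip s s.

(* The last summand dominates the risk on the event that some [`|ell (Y i)|]
   exceeds [L]. *)
Definition remainder w : R :=
  180 * (63 * (L ^+ 2 * m / n%:R *
      (2 * ln n%:R ^+ 2 + 4 * (good (sample Z w) * exp_total w)))
    + ip (eta k0) (eta k0) + 2 * (m / n%:R))
  + n%:R ^- 3 * (bad_cst * (n%:R * e_sum w)).

Let bad_cst_ge0 : 0 <= bad_cst.
Proof.
by rewrite addr_ge0 ?mulr_ge0 ?(psd_ge0 ps)// ?invr_ge0 ?sqr_ge0// ltW.
Qed.

Lemma risk_le_sum_sqr k w :
  risk k w <= 2 * (m * \sum_i ell (Z i w).2 ^+ 2 + ip s s).
Proof.
apply: le_trans (psdD_le ps _ _) _; rewrite (psdNl ps) (psdNr ps) opprK.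
rewrite ler_pM2l// lerD2r /emp_mean (psdZl ps) (psdZr ps).
apply: (@le_trans _ _ (n%:R^-1 * (n%:R^-1 * (n%:R * \sum_i ip (a k w i) (a k w i))))).
  by rewrite !ler_pM2l ?invr_gt0//; exact: (psd_sum_le ps (a k w)).
rewrite mulKf ?gt_eqF// mulr_sumr mulr_sumr; apply: ler_sum => i _.
rewrite /av (psdZl ps) (psdZr ps) mulrA -expr2 ler_pdivrMl//.
rewrite [leRHS]mulrA (mulrC n%:R) [leRHS]mulrC ler_wpM2l ?sqr_ge0//.
exact: ip_kv_le.
Qed.

(** With e_i = exp(alpha |ell(Y_i)| / 2), the risk is at most [bad_cst] times the sum of the e_i.
    Some e_j exceeds exp(alpha L / 2) >= n^3, so multiplying by n^-3 times the same sum only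
    increases the bound; Cauchy-Schwarz then turns the squared sum into full exponents alpha. *)
Lemma risk_bad k w : good (sample Z w) = 0 ->
  risk k w <= n%:R ^- 3 * (bad_cst * (n%:R * e_sum w)).
Proof.
rewrite good_forall; case: forallP => [_ /eqP|/existsNP[j /negP]]; first by rewrite oner_eq0.
rewrite tnth_mktuple /small -ltNge => Lj _.
pose e i := expR (alpha * `|ell (Z i w).2| / 2).
have e_ge1 i : 1 <= e i.
  apply: le_trans (expR_ge1Dx _); rewrite lerDl.
  by rewrite divr_ge0// mulr_ge0// ltW.
have esum1 : 1 <= \sum_i e i.
  rewrite (bigD1 j)//= (le_trans (e_ge1 j))// lerDl sumr_ge0// => i _.
  by rewrite expR_ge0.
have es0 : 0 <= \sum_i e i by rewrite (le_trans ler01).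
have sq i : ell (Z i w).2 ^+ 2 <= 8 / alpha ^+ 2 * e i.
  have p : 0 <= alpha * `|ell (Z i w).2| / 2 by rewrite divr_ge0// mulr_ge0// ltW.
  have := @expR_ge1Dxn R _ 1 p; rewrite -/(e i) (_ : 2`! = 2)// => H.
  have {}H : (alpha * `|ell (Z i w).2| / 2) ^+ 2 / 2 <= e i by rewrite (le_trans _ H)// lerDr.
  have -> : ell (Z i w).2 ^+ 2 = 8 / alpha ^+ 2 * ((alpha * `|ell (Z i w).2| / 2) ^+ 2 / 2).
    by rewrite !exprMn real_normK ?num_real//; field; exact: lt0r_neq0.
  by rewrite ler_wpM2l// divr_ge0// sqr_ge0.
have R1 : risk k w <= bad_cst * \sum_i e i.
  apply: le_trans (risk_le_sum_sqr k w) _.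
  have : \sum_i ell (Z i w).2 ^+ 2 <= 8 / alpha ^+ 2 * \sum_i e i.
    by rewrite mulr_sumr; apply: ler_sum => i _.
  move=> /(ler_wpM2l (ltW m0)) H1.
  have H2 : ip s s <= ip s s * \sum_i e i by rewrite ler_peMr// (psd_ge0 ps).
  apply: (@le_trans _ _ (2 * (m * (8 / alpha ^+ 2 * \sum_i e i) + ip s s * \sum_i e i))).
    by rewrite ler_pM2l// lerD.
  rewrite /bad_cst; lra.
apply: le_trans R1 _; rewrite mulrCA ler_wpM2l//.
have R2 : 1 <= n%:R ^- 3 * \sum_i e i.
  apply: (@le_trans _ _ (expR (- (alpha * L / 2)) * e j)).
    rewrite /e -expRD; apply: le_trans (expR_ge1Dx _); rewrite lerDl.
    have : alpha * L <= alpha * `|ell (Z j w).2| by rewrite ler_pM2l// ltW.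
    lra.
  rewrite ler_pM ?expR_ge0// (bigD1 j)//= lerDl sumr_ge0// => i _.
  by rewrite expR_ge0.
have R3 : (\sum_i e i) ^+ 2 <= n%:R * e_sum w.
  (* Multiplication of reals as a form, so that [psd_sum_le] is the scalar Cauchy-Schwarz
     inequality. *)
  have ro : @psd_form R R^o (fun x y => x * y).
    split=> [x y|c x y z|x]; [exact: mulrC|by rewrite mulrDl -scalerAl|].
    by rewrite -expr2 sqr_ge0.
  have := psd_sum_le ro e; rewrite -expr2 => /le_trans; apply.
  rewrite ler_wpM2l ?ler0n// ler_sum// => i _.
  by rewrite -expr2 /e -expRM_natr divfK.
have n3 : 0 <= n%:R ^- 3 :> R by rewrite invr_ge0 exprn_ge0 ?ler0n.
apply: le_trans (ler_wpM2l n3 R3).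
by rewrite expr2 mulrA ler_peMl.
Qed.

Lemma remainder_ge w :
  n%:R ^- 3 * (bad_cst * (n%:R * e_sum w)) <= remainder w.
Proof.
have g0 : 0 <= good (sample Z w) by rewrite good_forall ler0n.
rewrite /remainder lerDr mulr_ge0// addr_ge0//; last first.
  by rewrite mulr_ge0// divr_ge0 ?ler0n// ltW.
rewrite addr_ge0 ?(psd_ge0 ps)// mulr_ge0// mulr_ge0//.
  by rewrite divr_ge0 ?ler0n// mulr_ge0 ?sqr_ge0// ltW.
by rewrite addr_ge0// mulr_ge0 ?sqr_ge0// mulr_ge0 ?exp_total_ge0.
Qed.

Lemma oracle_pathwise k k' w th : 0 < th -> th < 1 -> crit k' w <= crit k w ->
  risk k' w <= (1 + th) * risk k w + remainder w / th.
Proof.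
move=> th0 th1 H.
have thV : 1 <= th^-1 by rewrite invf_ge1// ltW.
have es0 : 0 <= e_sum w by rewrite sumr_ge0// => i _; exact: expR_ge0.
have B0 : 0 <= n%:R ^- 3 * (bad_cst * (n%:R * e_sum w)).
  by rewrite !mulr_ge0 ?invr_ge0 ?exprn_ge0 ?ler0n.
have rk0 : 0 <= risk k w by exact: (psd_ge0 ps).
have : good (sample Z w) = 0 \/ good (sample Z w) = 1.
  by rewrite good_forall; case: [forall _, _]; [right|left].
case=> gE.
  apply: le_trans (risk_bad k' gE) _.
  apply: (@le_trans _ _ (remainder w / th)).
    apply: le_trans (remainder_ge w) _.
    by rewrite ler_peMr// (le_trans B0)// remainder_ge.
  by rewrite lerDr mulr_ge0// addr_ge0// ltW.
apply: le_trans (selection_control th0 th1 H) _; rewrite lerD2l.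
rewrite mulrA ler_wpM2r ?invr_ge0 ?(ltW th0)//.
by rewrite /remainder gE mul1r noise_levelE lerDl.
Qed.

Let good_ge0 w : 0 <= good (sample Z w). Proof. by rewrite good_forall ler0n. Qed.

Let good_exp_total w : good (sample Z w) * exp_total w = n%:R^-1 * \sum_k
  (good (sample Z w) * exp_dir k k0 w + good (sample Z w) * exp_dir k k w
   + (2 ^ n)%:R^-1 * (\sum_(I : {set 'I_n}) good (sample Z w) * exp_split k k0 I w
    + \sum_(I : {set 'I_n}) good (sample Z w) * exp_split k k I w)).
Proof.
have aux (J : finType) (g x y N : R) (f1 f2 : J -> R) :
    g * (x + y + N * (\sum_j f1 j + \sum_j f2 j)) =
    g * x + g * y + N * (\sum_j g * f1 j + \sum_j g * f2 j).
  by rewrite -!mulr_sumr; ring.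
rewrite /exp_total mulrCA mulr_sumr; congr (_ * _).
by apply: eq_bigr => k _; exact: aux.
Qed.

Let mean_exp_dir k k' :
  mean_le P (fun w => good (sample Z w) * exp_dir k k' w) (2 * expR mgf_cst).
Proof.
split; [exact: measurable_mgf_direction| |exact: mgf_direction].
by move=> w; rewrite mulr_ge0 ?expR_ge0.
Qed.

Let mean_exp_split k k' I :
  mean_le P (fun w => good (sample Z w) * exp_split k k' I w) (2 * expR mgf_cst).
Proof.
split; [exact: measurable_mgf_splitting| |exact: mgf_splitting].
by move=> w; rewrite mulr_ge0 ?expR_ge0.
Qed.

(** Four statistics per kernel, each of mean at most [2 * expR mgf_cst]; averaging over subsets and
    kernels preserves the bound. *)
Lemma mean_good_exp_total :
  mean_le P (fun w => good (sample Z w) * exp_total w) (8 * expR mgf_cst).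
Proof.
have N0 : (2 ^ n)%:R != 0 :> R by rewrite pnatr_eq0 expn_eq0.
rewrite (funext good_exp_total).
have c2n : #|{set 'I_n}| = (2 ^ n)%N.
  by rewrite -cardsT -powersetT card_powerset cardsT card_ord.
have H k : mean_le P (fun w => good (sample Z w) * exp_dir k k0 w
    + good (sample Z w) * exp_dir k k w
    + (2 ^ n)%:R^-1 * (\sum_(I : {set 'I_n}) good (sample Z w) * exp_split k k0 I w
    + \sum_(I : {set 'I_n}) good (sample Z w) * exp_split k k I w)) (8 * expR mgf_cst).
  rewrite (_ : 8 * _ = 2 * expR mgf_cst + 2 * expR mgf_cst + (2 ^ n)%:R^-1 *
      (#|{set 'I_n}|%:R * (2 * expR mgf_cst) + #|{set 'I_n}|%:R * (2 * expR mgf_cst))).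
    apply: mean_leD; first exact: mean_leD.
    apply: mean_leZ; first by rewrite invr_ge0 ler0n.
    by apply: mean_leD; exact: mean_le_sum.
  by rewrite c2n; field.
have := mean_leZ (_ : 0 <= n%:R^-1) (mean_le_sum H).
by rewrite invr_ge0 ler0n card_ord mulKf ?gt_eqF//; apply.
Qed.

Lemma mean_remainder : mean_le P remainder
  (180 * (63 * (L ^+ 2 * m / n%:R * (2 * ln n%:R ^+ 2 + 4 * (8 * expR mgf_cst)))
    + ip (eta k0) (eta k0) + 2 * (m / n%:R))
   + n%:R ^- 3 * (bad_cst * (n%:R * (#|'I_n|%:R * M)))).
Proof.
have mn : 0 <= m / n%:R by rewrite divr_ge0 ?ler0n// ltW.
have me i : mean_le P (fun w => expR (alpha * `|ell (Z i w).2|)) M.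
  split.
  - exact: (measurableT_comp (measurable_expR_ell alpha) (measurable_funPT (Z i))).
  - by move=> w; exact: expR_ge0.
  - rewrite (expectation_coord Z_iid i (phi := fun t : T => (expR (alpha * `|ell t.2|))%:E))//.
    by apply/measurable_EFinP; exact: measurable_expR_ell.
apply: mean_leD; last first.
  apply: mean_leZ; first by rewrite invr_ge0 exprn_ge0 ?ler0n.
  do 2 (apply: mean_leZ; first by rewrite ?ler0n).
  exact: mean_le_sum.
apply: mean_leZ => //; apply: mean_leD; last by apply: mean_le_cst; rewrite mulr_ge0.
apply: mean_leD; last by apply: mean_le_cst; exact: (psd_ge0 ps).
apply: mean_leZ => //; apply: mean_leZ.
  by rewrite divr_ge0 ?ler0n// mulr_ge0 ?sqr_ge0// ltW.
apply: mean_leD; first by apply: mean_le_cst; rewrite mulr_ge0 ?sqr_ge0.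
by apply: mean_leZ => //; exact: mean_good_exp_total.
Qed.

Lemma measurable_risk k : measurable_fun setT (risk k).
Proof.
rewrite (_ : risk k = fun w => n%:R ^- 2 *
    (\sum_i \sum_j ip (bv (h k) (Z i w)) (bv (h k) (Z j w)))
    + 2 * (n%:R^-1 * \sum_i ip (eta k) (bv (h k) (Z i w))) + ip (eta k) (eta k)).
  have mZ i := measurable_funPT (Z i).
  apply: measurable_funD => //; apply: measurable_funD.
    apply: measurable_funM => //; apply: measurable_sum => i; apply: measurable_sum => j.
    exact: (measurableT_comp (measurable_ip_bv2 (hreg k) (hreg k))
      (measurable_fun_pair (mZ i) (mZ j))).
  apply: measurable_funM => //; apply: measurable_funM => //; apply: measurable_sum => i.
  under eq_fun do rewrite /bv (psdBr ps).
  apply: measurable_funB => //.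
  exact: (measurableT_comp (measurable_ip_av (eta k) (hreg k)) (mZ i)).
apply/funext => w; rewrite /risk (emp_meanE n0 _ (sk k)) -addrA.
rewrite !(psdDl ps _ (eta k)) !(psdDr ps _ (eta k)) (psdC ps _ (eta k)).
rewrite (emp_noise_form ps) /emp_noise (psdZr ps) (psd_suml ps).
under eq_bigr do rewrite (psd_sumr ps).
by rewrite (psd_sumr ps); ring.
Qed.

Lemma l2norm_sq_estimator k w :
  l2norm_sq (fun x => estimator ell (sample Z w) (h k) x - s x) = (risk k w)%:E.
Proof.
rewrite (_ : (fun x => _) = (emp_mean (a k w) - s : L2)).
  by rewrite l2norm_sqE ?LfunP.
apply/funext => x; rewrite /estimator.
rewrite [RHS](_ : _ = n%:R^-1 * (\sum_i av ell (h k) (Z i w)) x - s x)//.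
congr (_ * _ - _); rewrite L2_sumE; apply: eq_bigr => i _.
rewrite tnth_mktuple [RHS](_ : _ = ell (Z i w).2 * kv (h k) (Z i w).1 x)//.
by rewrite (kvE (hreg k)) mulrC.
Qed.

Hypothesis hsym : forall k x y, h k x y = h k y x.

Lemma criterionE k w : criterion ell (sample Z w) (h k0) (h k) = (crit k w)%:E.
Proof.
rewrite /criterion /crit EFinD; congr (_ + _)%E.
  rewrite (_ : (fun x => _) = (emp_mean (a k w) - emp_mean (a k0 w) : L2)).
    by rewrite l2norm_sqE ?LfunP.
  apply/funext => x; rewrite /estimator.
  rewrite [RHS](_ : _ = n%:R^-1 * (\sum_i av ell (h k) (Z i w)) x
    - n%:R^-1 * (\sum_i av ell (h k0) (Z i w)) x)//.
  congr (_ * _ - _ * _); rewrite L2_sumE; apply: eq_bigr => i _;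
    rewrite tnth_mktuple.
    rewrite [RHS](_ : _ = ell (Z i w).2 * kv (h k) (Z i w).1 x)//.
    by rewrite (kvE (hreg k)) mulrC.
  rewrite [RHS](_ : _ = ell (Z i w).2 * kv (h k0) (Z i w).1 x)//.
  by rewrite (kvE (hreg k0)) mulrC.
congr EFin; rewrite /penalty [RHS]mulrA; congr (_ * _); apply: eq_bigr => i _.
rewrite tnth_mktuple /av (psdZl ps) (psdZr ps) mulrA -expr2 mulrC; congr (_ * _).
rewrite /ip (kvE (hreg k)) (kvE (hreg k0)).
by congr l2inner; apply/funext => x; exact: hsym.
Qed.

Context (Khat : n.-tuple T -> E -> E -> R) (KK : set (E -> E -> R)).
Hypothesis hKK : forall k, KK (h k).
Hypothesis KKh : forall K, KK K -> exists k, h k = K.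
Hypothesis Khat_meas : forall K, KK K -> measurable [set z | Khat z = K].
Hypothesis Khat_argmin : forall w,
  is_argmin KK (criterion ell (sample Z w) (h k0)) (Khat (sample Z w)).

Let selected_risk w : \bar R :=
  l2norm_sq (fun x => estimator ell (sample Z w) (Khat (sample Z w)) x - s x).

(** On each of finitely many measurable events, where [Khat] is a given kernel, it coincides with
    the risk of that kernel. *)
Let measurable_selected_risk : measurable_fun setT selected_risk.
Proof.
move=> _ A mA; rewrite setTI.
rewrite (_ : _ @^-1` A = \bigcup_(k in [set: 'I_n])
    (sample Z @^-1` [set z | Khat z = h k] `&` (fun w => (risk k w)%:E) @^-1` A)).
  apply: fin_bigcup_measurable => // k _; apply: measurableI.
    rewrite -[X in measurable X]setTI; apply: measurable_sample => //.
    exact: Khat_meas.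
  rewrite -[X in measurable X]setTI.
  have /measurable_EFinP mr := measurable_risk k.
  exact: mr.
apply/seteqP; split=> [w /= Aw|w [k _ [/= Kw]]].
  have [KKw _] := Khat_argmin w; have [k hk] := KKh KKw.
  by exists k => //; split => //=; rewrite -l2norm_sq_estimator hk.
by rewrite /= /selected_risk Kw l2norm_sq_estimator.
Qed.

Definition remainder_bound : R :=
  180 * (63 * (L ^+ 2 * m / n%:R * (2 * ln n%:R ^+ 2 + 4 * (8 * expR mgf_cst)))
    + ip (eta k0) (eta k0) + 2 * (m / n%:R))
   + n%:R ^- 3 * (bad_cst * (n%:R * (#|'I_n|%:R * M))).

Lemma oracle_inequality th : 0 < th -> th < 1 ->
  (\int[P]_w selected_risk w <=
   (1 + th)%:E * ereal_inf [set \int[P]_w l2norm_sq (fun x =>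
       (estimator ell (sample Z w) K x - s x)%R) | K in KK]
   + (remainder_bound / th)%:E)%E.
Proof.
move=> th0 th1.
pose F k : \bar R := (\int[P]_w (risk k w)%:E)%E.
have th10 : 0 <= 1 + th by rewrite addr_ge0// ltW.
have risk0 k w : (0 <= (risk k w)%:E)%E by rewrite lee_fin (psd_ge0 ps).
have mrisk k : measurable_fun setT (fun w => (risk k w)%:E).
  by apply/measurable_EFinP; exact: measurable_risk.
have [mrem rem0 rem_le] := mean_remainder.
have main k : (\int[P]_w selected_risk w <= (1 + th)%:E * F k + (remainder_bound / th)%:E)%E.
  apply: (@le_trans _ _ (\int[P]_w ((1 + th)%:E * (risk k w)%:E
      + (th^-1)%:E * (remainder w)%:E))%E).
    apply: ge0_le_integral => //.
    - by move=> w _; exact: l2norm_sq_ge0.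
    - by apply: emeasurable_funD; apply: emeasurable_funM => //; exact/measurable_EFinP.
    - move=> w _; have [KKw argw] := Khat_argmin w; have [k' hk] := KKh KKw.
      rewrite /selected_risk -hk l2norm_sq_estimator -!EFinM -EFinD lee_fin.
      rewrite (mulrC th^-1); apply: oracle_pathwise => //.
      by have := argw (h k) (hKK k); rewrite -hk !criterionE lee_fin.
  rewrite ge0_integralD//; first last.
  - by apply: emeasurable_funM => //; exact/measurable_EFinP.
  - by move=> w _; rewrite mule_ge0// lee_fin ?invr_ge0// ltW.
  - exact: emeasurable_funM.
  - by move=> w _; rewrite mule_ge0// lee_fin.
  have thV : (0 <= (th^-1)%:E)%E by rewrite lee_fin invr_ge0 ltW.
  have merem : measurable_fun setT (fun w => (remainder w)%:E) by exact/measurable_EFinP.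
  have rem0' w : (0 <= (remainder w)%:E)%E by rewrite lee_fin.
  rewrite ge0_integralZl// ge0_integralZl//.
  rewrite leeD2l// mulrC EFinM lee_wpmul2l// lee_fin invr_ge0 ltW//.
(* The infimum over the kernels is attained, so [main] at a minimiser is enough. *)
case: (@arg_minP _ _ _ k0 xpredT F isT) => k _ kmin.
apply: le_trans (main k) _; rewrite leeD2r// lee_wpmul2l ?lee_fin//.
apply: le_ereal_inf_tmp => _ [K /KKh[j <-] <-].
rewrite (_ : integral _ _ _ = F j); first exact: kmin.
by apply: eq_integral => w _; rewrite l2norm_sq_estimator.
Qed.

End oracle.

End moment_generating.

(** * Enumeration of the kernels and choice of the constant *)

Lemma surj_of_card_le (T : Type) n (A : set T) : A !=set0 -> (A #<= `I_n)%card ->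
  exists h : 'I_n -> T, (forall k, A (h k)) /\ (forall x, A x -> exists k, h k = x).
Proof.
move=> [x0 Ax0] /pcard_leP[f].
(* Indices outside the image of the injection [f] are sent to [x0]: the enumeration may repeat
   elements. *)
have ex (k : 'I_n) : exists x, A x /\ ((exists y, A y /\ f y = k) -> f x = k).
  have [[y [Ay fy]]|nex] := pselect (exists y, A y /\ f y = k); first by exists y.
  by exists x0; split.
have [h hP] := choice ex; exists h; split=> [k|x Ax]; first by case: (hP k).
have fx : (f x < n)%N by have := @funS _ _ _ _ f x Ax.
exists (Ordinal fx); have [Ah /(_ (ex_intro _ x (conj Ax erefl))) fh] := hP (Ordinal fx).
by apply: (@inj _ _ _ f); rewrite ?inE.
Qed.

Lemma regular_of_conditions (R : realType) (d n : nat)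
    (mu : probability ('rV[R]_d * R)%type R) (ell : R -> R)
    (KK : set ('rV[R]_d -> 'rV[R]_d -> R)) (m mbar : R) K :
  is_kernel K -> kernel_set_conditions mu ell n KK m mbar -> KK K ->
  regular_kernel mu ell (m * n%:R) m K.
Proof.
move=> [_ /measurable_continuous2 mK] cond KKK.
have nK x : (l2norm_sq (K x) <= (m * n%:R)%:E)%E.
  by apply: le_trans (cond_norm cond KKK); apply: ereal_sup_ubound; exists x.
split=> //; first exact: cond_mean cond _ KKK.
move=> u.
have Kx x : K x \in Lfun (lebesgue_rV R d) 2%:E.
  apply: Lfun2P; last by rewrite (le_lt_trans (nK x)) ?ltry.
  rewrite -[K x]/((fun p : 'rV[R]_d * 'rV[R]_d => K p.1 p.2) \o (fun y => (x, y))).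
  by apply: measurableT_comp; [exact: mK|exact: measurable_fun_pair].
have := cond_weak cond KKK (LfunP u).
rewrite (l2norm_sqE (LfunP u)) -EFinM; apply: le_trans.
rewrite le_eqVlt; apply/orP; left; apply/eqP; apply: eq_integral => z _.
by rewrite (psdC (ip_psd R d)) /ip /kv to_L2K.
Qed.

(** For n >= 2 the ratio q = ln n / ln 2 is at least 1, so constants and lower powers are dominated
    by higher powers of q. The remainder is of order q^4 / n, which is enlarged to q^5 / n; dividing
    by (ln 2)^5 returns to ln n. *)
Lemma remainder_le_log (R : realType) (n : nat) (alpha m C D M de : R) :
  let l2 : R := ln 2 in
  let L := 1 + 6 / alpha * ln n%:R in
  (1 < n)%N -> 0 < alpha -> 0 < m -> 0 <= C -> 0 <= D -> 0 <= M -> 0 <= de ->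
  180 * (63 * (L ^+ 2 * m / n%:R * (2 * ln n%:R ^+ 2 + 4 * (8 * C)))
    + de + 2 * (m / n%:R)) + n%:R ^- 3 * (D * (n%:R * (n%:R * M))) <=
  (180 + (180 * (63 * (m * (1 + 6 * l2 / alpha) ^+ 2 * (2 * l2 ^+ 2 + 32 * C))
    + 2 * m) + D * M) / l2 ^+ 5) * (de + ln n%:R ^+ 5 / n%:R).
Proof.
move=> l2 L n1 al0 m0 C0 D0 M0 de0.
have np : 0 < n%:R :> R by rewrite ltr0n (ltn_trans _ n1).
have l0 : 0 < l2 by rewrite ln_gt0// ltr1n.
pose q := ln n%:R / l2.
have q1 : 1 <= q.
  by rewrite ler_pdivlMr// mul1r /l2 ler_ln ?posrE// ler_nat.
have q0 : 0 <= q by apply: le_trans q1.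
have xE : ln n%:R = q * l2 by rewrite divfK// gt_eqF.
rewrite /L {L} xE; clearbody q; clearbody l2; set L := 1 + _.
set c1 := (X in (180 + X / _) * _).
have A0 : 0 <= 1 + 6 * l2 / alpha by rewrite addr_ge0// divr_ge0 ?mulr_ge0// ltW.
have B0 : 0 <= 2 * l2 ^+ 2 + 32 * C.
  by apply: addr_ge0; apply: mulr_ge0 => //; exact: sqr_ge0.
have L_le : L <= (1 + 6 * l2 / alpha) * q.
  rewrite /L [leRHS]mulrDl mul1r; apply: lerD => //.
  by rewrite le_eqVlt; apply/orP; left; apply/eqP; field; exact: lt0r_neq0.
have L0 : 0 <= L.
  by rewrite addr_ge0// mulr_ge0 ?divr_ge0 ?(ltW al0)// mulr_ge0// ltW.
have L2_le : L ^+ 2 <= (1 + 6 * l2 / alpha) ^+ 2 * q ^+ 2.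
  by rewrite -exprMn lerXn2r ?nnegrE// mulr_ge0.
have X_le : 2 * (q * l2) ^+ 2 + 4 * (8 * C) <= (2 * l2 ^+ 2 + 32 * C) * q ^+ 2.
  have : C <= C * q ^+ 2 by rewrite ler_peMr// exprn_ege1.
  by rewrite exprMn; lra.
have q45 : q ^+ 4 <= q ^+ 5 by rewrite ler_weXn2l.
have q5 : 1 <= q ^+ 5 by rewrite exprn_ege1.
have P_le : L ^+ 2 * (2 * (q * l2) ^+ 2 + 4 * (8 * C)) <=
    (1 + 6 * l2 / alpha) ^+ 2 * (2 * l2 ^+ 2 + 32 * C) * q ^+ 5.
  apply: (@le_trans _ _ (((1 + 6 * l2 / alpha) ^+ 2 * q ^+ 2) *
      ((2 * l2 ^+ 2 + 32 * C) * q ^+ 2))).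
    apply: ler_pM => //; first exact: sqr_ge0.
    by apply: addr_ge0; apply: mulr_ge0 => //; [exact: sqr_ge0|exact: mulr_ge0].
  rewrite (_ : _ * q ^+ 2 * _ =
    (1 + 6 * l2 / alpha) ^+ 2 * (2 * l2 ^+ 2 + 32 * C) * q ^+ 4); last by ring.
  by rewrite ler_wpM2l// mulr_ge0// sqr_ge0.
have c10 : 0 <= c1.
  apply: addr_ge0; last exact: mulr_ge0.
  apply: mulr_ge0 => //; apply: addr_ge0; last by rewrite mulr_ge0// ltW.
  by apply: mulr_ge0 => //; apply: mulr_ge0 => //; rewrite mulr_ge0 ?sqr_ge0// ltW.
apply: (@le_trans _ _ (180 * de + c1 * q ^+ 5 / n%:R)).
  rewrite -(ler_pM2l np).
  set lhs := (X in X <= _); set rhs := (X in _ <= X).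
  have -> : lhs = 180 * (63 * (m * (L ^+ 2 * (2 * (q * l2) ^+ 2 + 4 * (8 * C))))
      + n%:R * de + 2 * m) + D * M.
    by rewrite /lhs; field; exact: lt0r_neq0.
  have -> : rhs = 180 * (n%:R * de) + c1 * q ^+ 5.
    by rewrite /rhs; field; exact: lt0r_neq0.
  have h1 : m * (L ^+ 2 * (2 * (q * l2) ^+ 2 + 4 * (8 * C))) <=
      m * (1 + 6 * l2 / alpha) ^+ 2 * (2 * l2 ^+ 2 + 32 * C) * q ^+ 5.
    by rewrite -!(mulrA m) ler_pM2l.
  have h2 : m <= m * q ^+ 5 by rewrite ler_peMr// ltW.
  have h3 : D * M <= D * M * q ^+ 5 by rewrite ler_peMr// mulr_ge0.
  rewrite /c1; move: h1 h2 h3.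
  move: (m * (L ^+ 2 * _)) (m * _ * _) (n%:R * de) (D * M) (q ^+ 5) => a b c e f.
  lra.
have -> : c1 * q ^+ 5 / n%:R = c1 / l2 ^+ 5 * ((q * l2) ^+ 5 / n%:R).
  by rewrite exprMn; field; rewrite !gt_eqF.
rewrite [leRHS]mulrDl (mulrDr 180) (mulrDr (c1 / _)).
have : 0 <= 180 * ((q * l2) ^+ 5 / n%:R).
  by rewrite mulr_ge0// divr_ge0 ?(ltW np)// exprn_ge0// mulr_ge0// ltW.
have : 0 <= c1 / l2 ^+ 5 * de by rewrite mulr_ge0// divr_ge0// exprn_ge0// ltW.
set a := c1 / _ * de; set b := c1 / _ * (_ / _); set e := 180 * (_ / _).
by move: (180 * de) a b e => ? ? ? ?; lra.
Qed.

Theorem theorem3p2 (R : realType) (d : nat) (d_gt0 : (0 < d)%N)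
  (disp : measure_display) (Omega : measurableType disp) (P : probability Omega R)
  (mu : probability ('rV[R]_d * R)%type R)
  (mu_ac : mu `<< (lebesgue_rV R d \x lebesgue_measure)%E)
  (Z : forall n : nat, 'I_n -> {RV P >-> ('rV[R]_d * R)%type})
  (Z_iid : forall n : nat, (0 < n)%N -> iid_with_law mu (@Z n))
  (ell : R -> R) (ell_meas : measurable_fun [set: R] ell)
  (f r s : 'rV[R]_d -> R)
  (f_density : is_density_X mu f)
  (r_regression : is_regression mu ell r)
  (s_def : s = (fun x => r x * f x))
  (KK : nat -> set ('rV[R]_d -> 'rV[R]_d -> R))
  (KK_kernel : forall (n : nat) K, (0 < n)%N -> KK n K -> is_kernel K)
  (KK_nonempty : forall n : nat, (0 < n)%N -> KK n !=set0)
  (KK_card : forall n : nat, (0 < n)%N -> (KK n #<= `I_n)%card)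
  (m mbar : R) (m_gt0 : 0 < m) (mbar_gt0 : 0 < mbar)
  (KK_cond : forall n : nat, (0 < n)%N ->
    kernel_set_conditions mu ell n (KK n) m mbar)
  (K0 : nat -> 'rV[R]_d -> 'rV[R]_d -> R)
  (K0_argmax : forall n : nat, (0 < n)%N ->
    is_argmax (KK n) (@diag_sup R d) (K0 n))
  (Khat : forall n : nat, n.-tuple ('rV[R]_d * R) -> 'rV[R]_d -> 'rV[R]_d -> R)
  (Khat_meas : forall (n : nat) K, (0 < n)%N -> KK n K ->
    measurable [set z : n.-tuple ('rV[R]_d * R)%type | Khat n z = K])
  (Khat_argmin : forall (n : nat) (w : Omega), (0 < n)%N ->
    is_argmin (KK n) (criterion ell (sample (@Z n) w) (K0 n))
      (Khat n (sample (@Z n) w)))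
  (s_L2 : s \in Lfun (lebesgue_rV R d) 2%:E)
  (ell_exp : exists alpha : R, 0 < alpha /\
    (\int[mu]_z (expR (alpha * `|ell z.2|))%:E < +oo)%E) :
  exists c : R, 0 < c /\
    forall (n : nat) (theta : R), (0 < n)%N -> 0 < theta -> theta < 1 ->
    (\int[P]_w l2norm_sq (fun x =>
        (estimator ell (sample (@Z n) w) (Khat n (sample (@Z n) w)) x - s x)%R)
     <= (1 + theta)%:E *
          ereal_inf [set \int[P]_w l2norm_sq (fun x =>
              (estimator ell (sample (@Z n) w) K x - s x)%R) | K in KK n]
        + (c / theta)%:E *
          (l2norm_sq (fun x => (mean_estimator mu ell (K0 n) x - s x)%R)
           + (ln n%:R ^+ 5 / n%:R)%:E))%E.
Proof.
have [alpha [alpha0 expy]] := ell_exp.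
pose M := fine (\int[mu]_z (expR (alpha * `|ell z.2|))%:E).
have expM : (\int[mu]_z (expR (alpha * `|ell z.2|))%:E <= M%:E)%E.
  rewrite fineK// ge0_fin_numE//; apply: integral_ge0 => z _.
  by rewrite lee_fin expR_ge0.
pose s2 := to_L2 s.
have s2E : s2 = s :> (_ -> _) by exact: to_L2K.
pose C := expR (mgf_cst alpha M).
pose D := bad_cst alpha m s2.
pose l2 : R := ln 2.
have l2_gt0 : 0 < l2 by rewrite ln_gt0// ltr1n.
pose c1 := 180 * (63 * (m * (1 + 6 * l2 / alpha) ^+ 2 * (2 * l2 ^+ 2 + 32 * C)) + 2 * m)
  + D * M.
have M0 : 0 <= M by exact: (M_ge0 expM).
have D0 : 0 <= D.
  apply: addr_ge0; last by rewrite mulr_ge0// (psd_ge0 (ip_psd R d)).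
  by rewrite divr_ge0 ?sqr_ge0// mulr_ge0// ltW.
have C0 : 0 <= C by exact: expR_ge0.
have c1_ge0 : 0 <= c1.
  apply: addr_ge0; last exact: mulr_ge0.
  apply: mulr_ge0 => //; apply: addr_ge0; last by rewrite mulr_ge0// ltW.
  apply: mulr_ge0 => //; apply: mulr_ge0; first by rewrite mulr_ge0 ?sqr_ge0// ltW.
  by rewrite addr_ge0// mulr_ge0 ?sqr_ge0.
exists (180 + c1 / l2 ^+ 5); split.
  by rewrite ltr_pwDl// divr_ge0// exprn_ge0// ltW.
move=> n th n0 th0 th1.
have [h [hKK KKh]] := surj_of_card_le (KK_nonempty _ n0) (KK_card _ n0).
have hreg k : regular_kernel mu ell (m * n%:R) m (h k).
  exact: regular_of_conditions (KK_kernel _ _ n0 (hKK k)) (KK_cond _ n0) (hKK k).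
have hsym k x y : h k x y = h k y x by have [+ _] := KK_kernel _ _ n0 (hKK k); exact.
have [k0 hk0] : exists k0, h k0 = K0 n by apply: KKh; have [] := K0_argmax _ n0.
(* For n = 1 the logarithm is 0 and absorbs nothing, but then there is a single kernel and the
   selected risk is the minimal one. *)
have [n1|n1] := leqP n 1.
  have ord_eq0 (k : 'I_n) : val k = 0%N.
    by apply/eqP; rewrite -leqn0 -ltnS (leq_trans (ltn_ord k)).
  have hk (k : 'I_n) : h k = K0 n.
    by rewrite -hk0; congr h; apply/val_inj; rewrite !ord_eq0.
  have KhE w : Khat n (sample (@Z n) w) = K0 n.
    by have [/KKh[k <-] _] := Khat_argmin _ w n0.
  under eq_integral do rewrite KhE.
  set I := (X in (X <= _)%E); rewrite (_ : [set _ | K in KK n] = [set I]); last first.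
    apply/seteqP; split=> [_ [K /KKh[k <-] <-]|_ ->]; first by rewrite hk.
    by exists (K0 n) => //; rewrite -hk0.
  have I0 : (0 <= I)%E by apply: integral_ge0 => w _; exact: l2norm_sq_ge0.
  rewrite ereal_inf1 -[leLHS]adde0; apply: leeD.
    by rewrite -[leLHS]mul1e lee_wpmul2r// lee_fin lerDl ltW.
  rewrite mule_ge0//.
    by rewrite lee_fin divr_ge0 ?(ltW th0)// addr_ge0// divr_ge0// exprn_ge0// ltW.
  rewrite adde_ge0 ?l2norm_sq_ge0// lee_fin divr_ge0 ?ler0n// exprn_ge0//.
  by rewrite ln_ge0// ler1n.
(* The slope 6 / alpha makes exp(-alpha L / 2) at most n^-3; the summand 1 ensures L >= 1. *)
pose L := 1 + 6 / alpha * ln n%:R.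
have nR : 1 <= n%:R :> R by rewrite ler1n.
have ln0 : 0 <= ln n%:R :> R by exact: ln_ge0.
have L1 : 1 <= L by rewrite lerDl mulr_ge0// divr_ge0// ltW.
have np : 0 < n%:R :> R by rewrite ltr0n.
have Llarger : expR (- (alpha * L / 2)) <= n%:R ^- 3.
  have -> : n%:R ^- 3 = expR (- (3 * ln n%:R)) :> R.
    by rewrite expRN expRM_natl lnK.
  rewrite ler_expR lerN2.
  have -> : alpha * L / 2 = alpha / 2 + 3 * ln n%:R by rewrite /L; field; exact: lt0r_neq0.
  by rewrite lerDr divr_ge0// ltW.
have Llarge : expR (- (alpha * L / 2)) <= n%:R^-1.
  apply: le_trans Llarger _.
  by rewrite lef_pV2 ?posrE ?exprn_gt0 ?ltr0n// -[leLHS]expr1 ler_weXn2l.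
have Khat_argmin' w : is_argmin (KK n) (criterion ell (sample (@Z n) w) (h k0))
    (Khat n (sample (@Z n) w)).
  by rewrite hk0; exact: (Khat_argmin _ w n0).
have := oracle_inequality ell_meas alpha0 expM m_gt0 L1 n0 Llarge (Z_iid _ n0) (k0 := k0) Llarger
  s2 hreg hsym hKK KKh (fun K => Khat_meas n K n0) Khat_argmin' th0 th1.
rewrite s2E => oracle; apply: le_trans oracle _; rewrite leeD2l//.
have etaE : l2norm_sq (fun x => mean_estimator mu ell (K0 n) x - s x) =
    (ip (sv mu ell (h k0) - s2) (sv mu ell (h k0) - s2))%:E.
  rewrite -l2norm_sqE ?LfunP//; congr l2norm_sq; apply/funext => x.
  rewrite -hk0 [RHS](_ : _ = sv mu ell (h k0) x - s2 x)// s2E.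
  by rewrite (svE ell_meas (hreg k0)).
rewrite etaE -EFinD -EFinM lee_fin /remainder_bound -/D -/C card_ord.
move: (psd_ge0 (ip_psd R d) (sv mu ell (h k0) - s2)).
set de := ip _ _ => de0.
rewrite [leRHS]mulrAC ler_wpM2r ?invr_ge0 ?(ltW th0)//.
exact: remainder_le_log.
Qed.
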